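(* Let $(X,\tau,d)$ be an extended metric-topological space and, for $\lambda>0$, let $\mathsf{HK}_{d/\lambda}$ be the Hellinger-Kantorovich distance on $\mathcal M(X)$ induced by the distance $\lambda^{-1}d$. Then, for all $\mu_1,\mu_2\in\mathcal M(X)$, $$\lambda\,\mathsf{HK}_{d/\lambda}(\mu_1,\mu_2)\uparrow\mathsf W_d(\mu_1,\mu_2)\quad\text{as }\lambda\uparrow\infty,$$ i.e. $\lambda\mapsto\lambda\,\mathsf{HK}_{d/\lambda}(\mu_1,\mu_2)$ is nondecreasing and converges to $\mathsf W_d(\mu_1,\mu_2)\in[0,\infty]$.
   Context: An extended metric-topological space $(X,\tau,d)$ is a Hausdorff space $(X,\tau)$ with an extended distance $d:X\times X\to[0,\infty]$ lower semicontinuous w.r.t. $\tau$. $\mathcal M(X)$ is the set of finite nonnegative Radon measures on $X$. Kantorovich-Wasserstein distance: $\mathsf W_d^2(\mu_1,\mu_2)=\inf\{\int d^2(x_1,x_2)\,d\gamma:\gamma\in\mathcal M(X\times X),\ \pi^i_\sharp\gamma=\mu_i,\ i=1,2\}$, with value $+\infty$ if $\mu_1(X)\ne\mu_2(X)$. Hellinger-Kantorovich distance induced by an extended distance $d$: the cone $\mathfrak C$ is the quotient of $X\times[0,\infty)$ identifying all points $(x,0)$ to the vertex $\mathfrak o$; $d_{\mathfrak C}^2([x_1,r_1],[x_2,r_2])=r_1^2+r_2^2-2r_1r_2\cos(\min(d(x_1,x_2),\pi))$. Topology of $\mathfrak C$: that of $X\times(0,\infty)$ away from $\mathfrak o$,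 with the sets $\{[x,r]:r<\varepsilon\}$, $\varepsilon>0$, as neighborhood basis of $\mathfrak o$. $\mathsf r([x,r])=r$, $\mathsf x([x,r])=x$ if $r>0$, $\mathsf x(\mathfrak o)=\bar x$ a fixed point; on $\mathfrak C\times\mathfrak C$, $\mathsf x_i,\mathsf r_i$ refer to the $i$-th component. For a finite Radon measure $\alpha$ on $\mathfrak C\times\mathfrak C$ with $\int(\mathsf r_1^2+\mathsf r_2^2)\,d\alpha<\infty$, $\mathfrak h_i\alpha=(\mathsf x_i)_\sharp(\mathsf r_i^2\alpha)$. Then $\mathsf{HK}_d^2(\mu_1,\mu_2)=\min\{\int d_{\mathfrak C}^2\,d\alpha:\mathfrak h_1\alpha=\mu_1,\ \mathfrak h_2\alpha=\mu_2\}$ over such $\alpha$. *)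

(* Defs.v *)
From HB Require Import structures.
From mathcomp Require Import all_boot all_order all_algebra generic_quotient.
From mathcomp Require Import all_classical all_reals all_analysis.

Set Implicit Arguments.
Unset Strict Implicit.
Unset Printing Implicit Defensive.

Import Order.TTheory GRing.Theory Num.Theory.
Import numFieldNormedType.Exports.

Local Open Scope classical_set_scope.
Local Open Scope ring_scope.
Local Open Scope quotient_scope.

HB.instance Definition _ (X Y : ptopologicalType) :=
  Topological.on (X * Y)%type.

(* For products, this is the Borel sigma-algebra of the product topology; it
   may be strictly larger than the product of the Borel sigma-algebras. *)
Definition borel (X : ptopologicalType) : Type := g_sigma_algebraType (@open X).

HB.instance Definition _ (X : ptopologicalType) :=
  Measurable.copy (borel X) (g_sigma_algebraType (@open X)).

Definition radon (R : realType) (X : ptopologicalType)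
    (mu : {measure set (borel X) -> \bar R}) : Prop :=
  forall (B : set (borel X)) (e : R), measurable B -> 0 < e ->
    exists K : set X, [/\ compact K, K `<=` B & (mu (B `\` K) <= e%:E)%E].

Record extended_metric_topological (R : realType) (X : ptopologicalType)
    (d : X -> X -> \bar R) : Prop := {
  emt_hausdorff : hausdorff_space X ;
  emt_ge0 : forall x y, (0 <= d x y)%E ;
  emt_eq0 : forall x y, d x y = 0%E <-> x = y ;
  emt_sym : forall x y, d x y = d y x ;
  emt_triangle : forall x y z, (d x z <= d x y + d y z)%E ;
  emt_lsc : lower_semicontinuous (fun p : X * X => d p.1 p.2)
}.

(* Measures are only meaningful on measurable sets, hence agreement is required
   there only. *)
Definition eq_measurable (R : realType) (X : ptopologicalType)
    (m1 m2 : set (borel X) -> \bar R) : Prop :=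
  forall A : set (borel X), measurable A -> m1 A = m2 A.

Section kantorovich_wasserstein.
Context (R : realType) (X : ptopologicalType).
Implicit Types (d : X -> X -> \bar R) (mu : {finite_measure set (borel X) -> \bar R}).

Definition coupling mu1 mu2
    (gamma : {finite_measure set (borel (X * X)%type) -> \bar R}) : Prop :=
  [/\ radon gamma,
      eq_measurable
        (pushforward gamma (fst : borel (X * X)%type -> borel X)) mu1 &
      eq_measurable
        (pushforward gamma (snd : borel (X * X)%type -> borel X)) mu2].

(* If mu1 and mu2 have different masses there is no coupling, and the infimum
   is +oo. *)
Definition Wass d mu1 mu2 : \bar R :=
  sqrte (ereal_inf
    [set (\int[gamma]_p (d p.1 p.2 ^+ 2))%E | gamma in coupling mu1 mu2]).

End kantorovich_wasserstein.

Section cone.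
Context (R : realType) (X : ptopologicalType).

Definition halfline : Type := [set r : R | 0 <= r].
HB.instance Definition _ := Topological.on halfline.

Definition cone_rel : rel (X * halfline) :=
  fun p q => (p == q) || (\val p.2 == 0) && (\val q.2 == 0).

Lemma cone_rel_equiv : equiv_class_of cone_rel.
Proof.
split=> [p|p q|q p s]; rewrite /cone_rel; first by rewrite eqxx.
  by rewrite eq_sym andbC.
move=> /predU1P[->//|/andP[p0 q0]] /predU1P[<-|/andP[_ s0]].
  by rewrite p0 q0 orbT.
by rewrite p0 s0 orbT.
Qed.

Canonical cone_equiv := EquivRelPack cone_rel_equiv.

Definition cone : Type := {eq_quot cone_equiv}.
HB.instance Definition _ := Choice.on cone.
HB.instance Definition _ := Quotient.on cone.
HB.instance Definition _ := EqQuotient.on cone.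

Fact halfline0_subproof : (0 : R) \in [set r : R | 0 <= r].
Proof. by rewrite inE /=. Qed.

Definition halfline0 : halfline := exist _ 0 halfline0_subproof.

Definition vertex : cone := \pi_cone (point, halfline0).

HB.instance Definition _ := isPointed.Build cone vertex.

Definition cone_r (z : cone) : R := \val (repr z).2.

(* The base point of X plays the role of the fixed value of the projection at
   the vertex. *)
Definition cone_x (z : cone) : X :=
  if 0 < cone_r z then (repr z).1 else point.

Lemma cone_r_pi p : cone_r (\pi_cone p) = \val p.2.
Proof.
rewrite /cone_r; have /eqmodP/predU1P[->//|/andP[/eqP-> /eqP->]] //:
  repr (\pi_cone p) = p %[mod cone] by rewrite reprK.
Qed.

Lemma cone_x_pi p : 0 < \val p.2 -> cone_x (\pi_cone p) = p.1.
Proof.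
move=> p0; rewrite /cone_x cone_r_pi p0.
have /eqmodP/predU1P[->//|/andP[_ /eqP p20]] :
  repr (\pi_cone p) = p %[mod cone] by rewrite reprK.
by rewrite p20 ltxx in p0.
Qed.

(* Not the quotient topology: it is coarser at the vertex. *)
Definition cone_open (U : set cone) : Prop :=
  open [set p : X * halfline | 0 < \val p.2 /\ U (\pi_cone p)] /\
  (U vertex -> exists2 e : R, 0 < e & [set z | cone_r z < e] `<=` U).

Lemma cone_openT : cone_open setT.
Proof.
split; last by move=> _; exists 1.
have -> : [set p : X * halfline | 0 < \val p.2 /\ setT (\pi_cone p)] =
    (fun p : X * halfline => set_val p.2) @^-1` [set r | 0 < r].
  by apply/seteqP; split=> p //= [].
apply: open_comp; last exact: open_gt.
move=> p _; apply: (@continuous_comp _ _ _ snd set_val).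
  exact: cvg_snd.
exact: initial_continuous.
Qed.

Lemma cone_openI : setI_closed cone_open.
Proof.
move=> U V [oU vU] [oV vV]; split.
  rewrite (_ : [set p | _] =
    [set p : X * halfline | 0 < \val p.2 /\ U (\pi_cone p)] `&`
    [set p | 0 < \val p.2 /\ V (\pi_cone p)]); first exact: openI.
  by apply/seteqP; split=> p /=; [move=> [? []]|move=> [[? ?] []]].
move=> [/vU[e e0 eU] /vV[f f0 fV]]; exists (Num.min e f).
  by rewrite lt_min e0.
by move=> z /=; rewrite lt_min => /andP[/eU ? /fV].
Qed.

Lemma cone_open_bigU (I : Type) (f : I -> set cone) :
  (forall i, cone_open (f i)) -> cone_open (\bigcup_i f i).
Proof.
move=> of_; split.
  rewrite (_ : [set p | _] =
    \bigcup_i [set p : X * halfline | 0 < \val p.2 /\ f i (\pi_cone p)]).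
    by apply: bigcup_open => i _; exact: (of_ i).1.
  apply/seteqP; split=> p /=; first by move=> [? [i _ ?]]; exists i.
  by move=> [i _ [? ?]]; split=> //; exists i.
move=> [i _ /(of_ i).2[e e0 sub]]; exists e => // z /sub ?.
by exists i.
Qed.

HB.instance Definition _ :=
  isOpenTopological.Build cone cone_openT cone_openI cone_open_bigU.

Lemma nbhs_vertex (U : set cone) :
  nbhs vertex U <-> exists2 e : R, 0 < e & [set z | cone_r z < e] `<=` U.
Proof.
rewrite nbhsE; split=> [[V [[oV vV] Vv] VU]|[e e0 eU]].
  have [e e0 eV] := vV Vv.
  by exists e => //; exact: subset_trans VU.
exists [set z | cone_r z < e] => //; split.
  split; last by exists e.
  rewrite (_ : [set p | _] = (fun p : X * halfline => set_val p.2) @^-1`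
      ([set r | 0 < r] `&` [set r | r < e])).
    apply: open_comp; last by apply: openI; [exact: open_gt|exact: open_lt].
    move=> p _; apply: (@continuous_comp _ _ _ snd set_val).
      exact: cvg_snd.
    exact: initial_continuous.
  by apply/seteqP; split=> p /=; rewrite cone_r_pi.
by rewrite /= /vertex cone_r_pi.
Qed.

Definition cone_dist2 (d : X -> X -> \bar R) (z1 z2 : cone) : R :=
  cone_r z1 ^+ 2 + cone_r z2 ^+ 2 -
  2 * cone_r z1 * cone_r z2 *
    cos (fine (Order.min (d (repr z1).1 (repr z2).1) pi%:E)).

Lemma cone_dist2_pi (d : X -> X -> \bar R) (p q : X * halfline) :
  cone_dist2 d (\pi_cone p) (\pi_cone q) =
  \val p.2 ^+ 2 + \val q.2 ^+ 2 -
  2 * \val p.2 * \val q.2 * cos (fine (Order.min (d p.1 q.1) pi%:E)).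
Proof.
rewrite /cone_dist2 !cone_r_pi.
have /eqmodP/predU1P[->//|/andP[_ /eqP->]] :
  repr (\pi_cone p) = p %[mod cone] by rewrite reprK.
  have /eqmodP/predU1P[->//|/andP[_ /eqP->]] :
    repr (\pi_cone q) = q %[mod cone] by rewrite reprK.
  by rewrite mulr0 !mul0r.
by rewrite mulr0 !mul0r.
Qed.

End cone.

Section hellinger_kantorovich.
Context (R : realType) (X : ptopologicalType).
Implicit Types (d : X -> X -> \bar R) (mu : {finite_measure set (borel X) -> \bar R}).

Local Notation C := (cone R X).
Local Notation CC := (borel (C * C)%type).
Implicit Type alpha : {finite_measure set CC -> \bar R}.

(* Homogeneous marginal; p is one of the two projections. *)
Definition hmarginal alpha (p : C * C -> C) : set (borel X) -> \bar R :=
  pushforward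
    (fun B : set CC => \int[alpha]_(z in B) ((cone_r (p z) ^+ 2)%:E))%E
    ((fun z => cone_x (p z)) : CC -> borel X).

Definition hk_plan mu1 mu2 alpha : Prop :=
  [/\ radon alpha,
      (\int[alpha]_z ((cone_r z.1 ^+ 2 + cone_r z.2 ^+ 2)%:E) < +oo)%E,
      eq_measurable (hmarginal alpha fst) mu1 &
      eq_measurable (hmarginal alpha snd) mu2].

(* The infimum is attained, hence a minimum. *)
Definition HK d mu1 mu2 : \bar R :=
  sqrte (ereal_inf
    [set (\int[alpha]_z ((cone_dist2 d z.1 z.2)%:E))%E
      | alpha in hk_plan mu1 mu2]).

End hellinger_kantorovich.

Definition scale_dist (R : realType) (X : Type) (lambda : R)
    (d : X -> X -> \bar R) : X -> X -> \bar R :=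
  fun x y => ((lambda^-1)%:E * d x y)%E.

(* Main.v *)
Require Import Defs.
From HB Require Import structures.
From mathcomp Require Import all_boot all_order all_algebra generic_quotient.
From mathcomp Require Import all_classical all_reals all_analysis.
From mathcomp Require Import measurable_realfun ring lra.

(** Writing theta for the cone angle min(d / l, pi), the squared cone distance
    for d / l is (r1 - r2)^2 + 4 r1 r2 sin^2(theta / 2).  After multiplication
    by l^2 it is nondecreasing in l, because l sin(min(d / l, pi) / 2) is
    ([chord_monotone], a consequence of the concavity of the sine); integrating
    against a fixed plan gives the monotonicity of l HK_(d/l).

    A coupling becomes a plan when both base points are given radius 1; since
    2 sin(theta / 2) <= theta <= d / l, its l^2-scaled cost is at most its
    transport cost ([plan_of_coupling]), so l HK_(d/l) <= W_d.

    For the converse, suppose that for every l some plan alpha_l has l^2-scaled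
    cost at most S; a coupling of cost at most S is needed
    ([coupling_of_plans]).  The term l^2 (r1 - r2)^2 forces r1 and r2 to be
    close, so the image of min(r1, r2)^2 alpha_l under the pair of base points
    has marginals below mu1 and mu2 with a defect O(1 / l)
    ([partial_coupling_fst], [partial_coupling_snd]), and
    l^2 4 sin^2(theta / 2) approximates d^2 from below, uniformly where d is
    bounded ([truncated_dist_le_chord]).  What remains is a compactness argument
    in a space that is only Hausdorff.  Along an ultrafilter the values of these
    partial couplings on each Borel set converge, and the limit is a finitely
    additive set function with marginals exactly mu1 and mu2.  As mu1 and mu2
    are Radon, this set function is inner regular on open rectangles, which form
    a base of the product topology; that is enough to construct from it a Radon
    measure that agrees with it on open rectangles and does not exceed it on
    open sets ([exists_radon_extension]).  Agreement on rectangles makes the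
    measure a coupling, and the inequality on open sets gives the lower
    semicontinuity of the cost, since the superlevel sets of d are open. *)

Set Implicit Arguments.
Unset Strict Implicit.
Unset Printing Implicit Defensive.

Import Order.TTheory GRing.Theory Num.Theory.
Import numFieldNormedType.Exports.

Local Open Scope classical_set_scope.
Local Open Scope ring_scope.

(** * Radon measures from finitely additive set functions *)

(** Induction over a finite open cover, with the cover hidden. *)
Lemma compact_open_ind (T : ptopologicalType) (K : set T) (Q : set T -> Prop) :
  compact K -> Q set0 -> (forall A B, Q A -> Q B -> Q (A `|` B)) ->
  (forall x, K x -> exists U, [/\ open U, U x & Q U]) ->
  exists2 U, Q U & K `<=` U.
Proof.
rewrite compact_cover => Kc Q0 QU KQ.
have /choice[f fP] x : exists U, K x -> [/\ open U, U x & Q U].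
  by have [/KQ[U ?]|nKx] := pselect (K x); [exists U|exists set0].
have [i /fP[]//|x Kx|D DK KD] := Kc T K f.
  by exists x => //; have [] := fP _ Kx.
exists (\big[setU/set0]_(i <- finmap.enum_fset D) f i); last by rewrite -bigcup_fset.
rewrite big_seq; elim/big_ind: _ => // i iD.
by have /DK := iD; rewrite inE => /fP[].
Qed.

Lemma hausdorff_setX (X Y : topologicalType) :
  hausdorff_space X -> hausdorff_space Y -> hausdorff_space (X * Y)%type.
Proof.
move=> hX hY [x1 y1] [x2 y2] /= h; congr pair.
- apply: hX => A B Ax Bx.
  have [||[a b] [[/= Aa _] [Ba _]]] := h (A `*` setT) (B `*` setT).
  + by exists (A, setT) => //; split=> //; exact: filterT.
  + by exists (B, setT) => //; split=> //; exact: filterT.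
  by exists a.
- apply: hY => A B Ay By.
  have [||[a b] [[/= _ Ab] [_ Bb]]] := h (setT `*` A) (setT `*` B).
  + by exists (setT, A) => //; split=> //; exact: filterT.
  + by exists (setT, B) => //; split=> //; exact: filterT.
  by exists b.
Qed.

Lemma open_borel (Y : ptopologicalType) (A : set Y) :
  open A -> measurable (A : set (borel Y)).
Proof. by move=> oA; exact: sub_sigma_algebra. Qed.

Lemma closed_borel (Y : ptopologicalType) (A : set Y) :
  closed A -> measurable (A : set (borel Y)).
Proof.
move=> cA; rewrite -(setCK A); apply: measurableC.
by apply: open_borel; exact: closed_openC.
Qed.

(** The set function [b] is only finitely additive.  Values on compact sets
    determine an outer measure, by inner approximation of open sets and then
    outer approximation of arbitrary sets; it is a Radon measure on Borel sets
    as soon as [b] is inner regular on the members of a base and on the whole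
    space. *)
Section content_extension.
Context (R : realType) (Y : ptopologicalType).
Variable b : set (borel Y) -> R.
Hypothesis hY : hausdorff_space Y.
Hypothesis b_ge0 : forall A, measurable A -> 0 <= b A.
Hypothesis b_add : forall A B, measurable A -> measurable B ->
  A `&` B = set0 -> b (A `|` B) = b A + b B.

(** On these open sets [b] already has the inner regularity of a Radon
    measure, and the measure constructed below agrees with it. *)
Definition tight_open (V : set Y) := open V /\
  forall e : R, 0 < e -> exists K, [/\ compact K, K `<=` V & b (V `\` K) <= e].

Hypothesis tight_base : forall (G : set Y) x, open G -> G x ->
  exists V, [/\ tight_open V, V x & V `<=` G].
Hypothesis tightT : tight_open setT.

Let mo (A : set Y) : open A -> measurable (A : set (borel Y)).
Proof. exact: open_borel. Qed.
Let mc (A : set Y) : compact A -> measurable (A : set (borel Y)).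
Proof. by move=> cA; apply: closed_borel; exact: compact_closed. Qed.
Hint Resolve mo mc : core.

Lemma content0 : b set0 = 0.
Proof.
have := b_add measurable0 measurable0 (setI0 set0).
by rewrite setU0 => /eqP; rewrite -subr_eq0 opprD addrA subrr sub0r oppr_eq0
  => /eqP.
Qed.

Lemma contentD A B : measurable A -> measurable B -> B `<=` A ->
  b A = b B + b (A `\` B).
Proof.
move=> mA mB BA; rewrite -b_add//; first by rewrite setDUK.
  exact: measurableD.
by rewrite setDIK.
Qed.

Lemma le_content A B : measurable A -> measurable B -> A `<=` B -> b A <= b B.
Proof.
move=> mA mB AB; rewrite (contentD mB mA AB) lerDl b_ge0//.
exact: measurableD.
Qed.

Lemma contentU A B : measurable A -> measurable B ->
  b A + b B = b (A `|` B) + b (A `&` B).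
Proof.
move=> mA mB; rewrite (contentD (measurableU _ _ mA mB) mA (@subsetUl _ A B)).
rewrite (_ : (A `|` B) `\` A = B `\` (A `&` B)).
  rewrite -addrA; congr (_ + _); rewrite addrC.
  by rewrite -(contentD mB (measurableI _ _ mA mB) (@subIsetr _ A B)).
apply/seteqP; split=> x /=; first by move=> [[//|Bx] nAx]; split=> // -[].
by move=> [Bx nAB]; split; [right|move=> Ax; apply: nAB].
Qed.

Lemma content_leU A B : measurable A -> measurable B ->
  b (A `|` B) <= b A + b B.
Proof.
by move=> mA mB; rewrite contentU// lerDl b_ge0//; exact: measurableI.
Qed.

Lemma tight_openU V W : tight_open V -> tight_open W -> tight_open (V `|` W).
Proof.
move=> [oV tV] [oW tW]; split=> [|e e0]; first exact: openU.
have e20 : 0 < e / 2 by rewrite divr_gt0.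
have [K [cK KV bK]] := tV _ e20; have [L [cL LW bL]] := tW _ e20.
exists (K `|` L); split; [exact: compactU|exact: setUSS|].
have mV : measurable ((V `\` K) : set (borel Y)) by apply: measurableD; auto.
have mW : measurable ((W `\` L) : set (borel Y)) by apply: measurableD; auto.
apply: (@le_trans _ _ (b ((V `\` K) `|` (W `\` L)))).
  apply: le_content.
  - by apply: measurableD; apply: measurableU; auto.
  - exact: measurableU.
  - by move=> x [[Vx|Wx]] /not_orP[nK nL]; [left|right].
apply: (le_trans (content_leU mV mW)).
by rewrite [e]splitr lerD.
Qed.

Lemma tight_open0 : tight_open set0.
Proof.
split; first exact: open0.
move=> e e0; exists set0; split=> //; first exact: compact0.
by rewrite setD0 content0 ltW.
Qed.

Definition inner_content (G : set Y) : \bar R :=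
  ereal_sup [set (b K)%:E | K in [set K | compact K /\ K `<=` G]].

Definition outer_content (E : set Y) : \bar R :=
  ereal_inf [set inner_content G | G in [set G | open G /\ E `<=` G]].

Local Open Scope ereal_scope.

Lemma inner_content_ge0 G : 0 <= inner_content G.
Proof.
apply: ereal_sup_ubound => /=; exists set0; last by rewrite content0.
by split=> //; exact: compact0.
Qed.

Lemma le_inner_content G H : G `<=` H -> inner_content G <= inner_content H.
Proof.
move=> GH; apply: le_ereal_sup => _ [K [cK KG] <-].
by exists K => //; split=> //; exact: subset_trans GH.
Qed.

Lemma inner_content_le G : open G -> inner_content G <= (b G)%:E.
Proof.
move=> oG; apply: ge_ereal_sup => _ [K [cK KG] <-].
by rewrite lee_fin le_content//; auto.
Qed.

Lemma inner_content_tight V : tight_open V -> inner_content V = (b V)%:E.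
Proof.
move=> [oV tV]; apply/eqP; rewrite eq_le inner_content_le//=.
apply/lee_addgt0Pr => e e0; have [K [cK KV bK]] := tV _ e0.
rewrite (@contentD V K)//; [|auto|auto].
rewrite EFinD leeD ?lee_fin//.
by apply: ereal_sup_ubound; exists K.
Qed.

Lemma tight_inner_content V G : tight_open V -> V `<=` G ->
  (b V)%:E <= inner_content G.
Proof.
by move=> tV VG; rewrite -inner_content_tight//; exact: le_inner_content.
Qed.

Lemma inner_content_fin G : open G -> inner_content G \is a fin_num.
Proof.
move=> oG; rewrite ge0_fin_numE ?inner_content_ge0//.
by rewrite (le_lt_trans (inner_content_le oG))// ltry.
Qed.

(** Countable subadditivity is where finite additivity turns into countable
    additivity: a compact subset of the union is covered by finitely many tight
    sets, each inside one member of the family. *)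
Lemma inner_content_bigcup (G : (set Y)^nat) : (forall i, open (G i)) ->
  inner_content (\bigcup_i G i) <= \sum_(i <oo) inner_content (G i).
Proof.
move=> oG; apply: ge_ereal_sup => _ [K [cK KG] <-].
(* Quantifying over [W] makes [Q] stable under unions, member by member. *)
pose Q U := exists n (W : (set Y)^nat),
  [/\ forall i, tight_open (W i) /\ W i `<=` G i &
      U = \big[setU/set0]_(i < n) W i].
have [U [n [W [WG ->]]] KU] : exists2 U, Q U & K `<=` U.
  apply: compact_open_ind => //.
  - exists 0%N, (fun=> set0); split; last by rewrite big_ord0.
    by move=> i; split; [exact: tight_open0|].
  - move=> A B [n [W [WG ->]]] [m [V [VG ->]]].
    pose W' i := if (i < n)%N then W i else set0.
    pose V' i := if (i < m)%N then V i else set0.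
    exists (maxn n m), (fun i => W' i `|` V' i); split.
      move=> i; have [tW sW] := WG i; have [tV sV] := VG i.
      rewrite /W' /V'; case: ifP => _; case: ifP => _; split=> //;
        rewrite ?setU0 ?set0U//; try exact: tight_openU; try exact: tight_open0.
      by rewrite subUset.
    rewrite -(bigcup_mkord n) -(bigcup_mkord m).
    rewrite -(bigcup_mkord (maxn n m) (fun i => W' i `|` V' i)).
    apply/seteqP; split=> x /=.
      move=> [[i /= im Wx]|[i /= im Vx]]; exists i => /=.
      + by rewrite leq_max im.
      + by left; rewrite /W' im.
      + by rewrite leq_max im orbT.
      + by right; rewrite /V' im.
    move=> [i /= _]; rewrite /W' /V' => -[].
      by case: ifP => // im Wx; left; exists i.
    by case: ifP => // im Vx; right; exists i.
  - move=> x /KG[k _ Gkx]; have [V [tV Vx VG]] := tight_base (oG k) Gkx.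
    exists V; split=> //; first by case: tV.
    exists k.+1, (fun i => if i == k then V else set0); split.
      move=> i; case: eqP => [->|_]; first by split.
      by split=> //; exact: tight_open0.
    rewrite -(bigcup_mkord k.+1 (fun i => if i == k then V else set0)).
    apply/seteqP; split=> y /=.
      by move=> Vy; exists k => /=; rewrite ?eqxx.
    by move=> [i /= _]; case: eqP.
have mW i : measurable (W i : set (borel Y)) by apply: mo; have [[? ?] ?] := WG i.
have step : (b (\big[setU/set0]_(i < n) W i) <= \sum_(i < n) b (W i))%R.
  elim: n {KU} => [|n ih]; first by rewrite !big_ord0 content0.
  rewrite !big_ord_recr/=; apply: (le_trans (content_leU _ _)) => //.
    by apply: bigsetU_measurable => i _.
  exact: lerD.
have {}step : (b K <= \sum_(i < n) b (W i))%R.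
  apply: le_trans step; apply: le_content => //; first by auto.
  by apply: bigsetU_measurable => i _.
apply: (@le_trans _ _ (\sum_(i < n) inner_content (G i))).
  apply: (@le_trans _ _ (\sum_(i < n) b (W i))%R%:E); first by rewrite lee_fin.
  rewrite -sumEFin; apply: lee_sum => i _.
  by apply: tight_inner_content; have [] := WG i.
rewrite -(big_mkord xpredT (fun i => inner_content (G i))).
by apply: nneseries_lim_ge => i _ _; exact: inner_content_ge0.
Qed.

Lemma outer_content_open G : open G -> outer_content G = inner_content G.
Proof.
move=> oG; apply/eqP; rewrite eq_le; apply/andP; split.
  by apply: ereal_inf_lbound; exists G => //; split.
by apply: le_ereal_inf_tmp => _ [H [oH GH] <-]; exact: le_inner_content.
Qed.

Lemma outer_content0 : outer_content set0 = 0.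
Proof.
rewrite outer_content_open; last exact: open0.
by rewrite inner_content_tight ?content0//; exact: tight_open0.
Qed.

Lemma outer_content_ge0 E : 0 <= outer_content E.
Proof. by apply: le_ereal_inf_tmp => _ [H _ <-]; exact: inner_content_ge0. Qed.

Lemma outer_content_le_inner E G : open G -> E `<=` G ->
  outer_content E <= inner_content G.
Proof. by move=> oG EG; apply: ereal_inf_lbound; exists G. Qed.

Lemma le_outer_content : {homo outer_content : A B / A `<=` B >-> A <= B}.
Proof.
move=> A B AB; apply: le_ereal_inf_tmp => _ [H [oH BH] <-].
by apply: outer_content_le_inner => //; exact: subset_trans BH.
Qed.

Lemma outer_content_fin E : outer_content E \is a fin_num.
Proof.
rewrite ge0_fin_numE ?outer_content_ge0//.
apply: le_lt_trans (_ : inner_content setT < _).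
  by apply: outer_content_le_inner => //; exact: openT.
by rewrite inner_content_tight// ltry.
Qed.

Lemma outer_content_approx E (e : R) : (0 < e)%R ->
  exists G, [/\ open G, E `<=` G & inner_content G <= outer_content E + e%:E].
Proof.
move=> e0; have [_ [G [oG EG] <-] /ltW h] :=
  lb_ereal_inf_adherent e0 (outer_content_fin E).
by exists G.
Qed.

Lemma outer_content_sigma_subadditive : sigma_subadditive outer_content.
Proof.
move=> F; apply/lee_addgt0Pr => e e0.
have /choice[G GP] i : exists G, [/\ open G, F i `<=` G &
    inner_content G <= outer_content (F i) + (e / (2 ^ i.+1)%:R)%:E].
  by apply: outer_content_approx; rewrite divr_gt0// ltr0n expn_gt0.
apply: (@le_trans _ _ (inner_content (\bigcup_i G i))).
  apply: outer_content_le_inner.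
    by apply: bigcup_open => i _; have [] := GP i.
  by apply: subset_bigcup => i _; have [] := GP i.
apply: (le_trans (inner_content_bigcup _)); first by move=> i; have [] := GP i.
apply: (@le_trans _ _
    (\sum_(i <oo) (outer_content (F i) + (e / (2 ^ i.+1)%:R)%:E))).
  apply: lee_nneseries => i _; first by move=> _; exact: inner_content_ge0.
  by have [] := GP i.
by apply: epsilon_trick (ltW e0) => // i; exact: outer_content_ge0.
Qed.

HB.instance Definition _ := isOuterMeasure.Build R Y outer_content
  outer_content0 outer_content_ge0 le_outer_content
  outer_content_sigma_subadditive.

(** Replaces a compact subset of an open set by a tight open one, on which the
    outer content can be evaluated exactly. *)
Lemma tight_between K G : compact K -> open G -> K `<=` G ->
  exists V, [/\ tight_open V, K `<=` V & V `<=` G].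
Proof.
move=> cK oG KG.
have [|A B [tA AG] [tB BG]|x Kx|V [tV VG] KV] :=
  @compact_open_ind _ K (fun V => tight_open V /\ V `<=` G) cK.
- by split; [exact: tight_open0|].
- by split; [exact: tight_openU|rewrite subUset].
- have [V [tV Vx VG]] := tight_base oG (KG _ Kx).
  by exists V; split=> //; case: tV.
- by exists V.
Qed.

(** The content is superadditive over [G] and its complement inside an open
    set [H].  A tight set [V] nearly exhausts [H `&` G]; a compact [K] nearly
    exhausts [V]; a tight set [W] nearly exhausts the open set [H `&` ~` K],
    which contains [H `&` ~` G].  The overlap of [V] and [W] lies in [V `\` K],
    so that [b V + b W] exceeds [b (V `|` W)] only slightly. *)
Lemma inner_content_split G H : open G -> open H ->
  outer_content (H `&` G) + outer_content (H `&` ~` G) <= inner_content H.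
Proof.
move=> oG oH; apply/lee_addgt0Pr => e e0.
have e30 : (0 < e / 3)%R by rewrite divr_gt0.
have oHG : open (H `&` G) by exact: openI.
have [V [tV VHG iV]] : exists V, [/\ tight_open V, V `<=` H `&` G &
    inner_content (H `&` G) <= (b V + e / 3)%:E].
  have [_ [K [cK KHG] <-]] :=
    ub_ereal_sup_adherent e30 (inner_content_fin oHG).
  rewrite -/(inner_content _) => hK.
  have [V [tV KV VHG]] := tight_between cK oHG KHG.
  exists V; split=> //.
  rewrite EFinD -leeBlDr//; apply: (le_trans (ltW hK)); rewrite lee_fin.
  by apply: le_content => //; case: (tV); auto.
have [oV ktV] := tV; have [K [cK KV bK]] := ktV _ e30.
have oHK : open (H `&` ~` K).
  by apply: openI => //; apply: closed_openC; exact: compact_closed.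
have [W [tW WHK iW]] : exists W, [/\ tight_open W, W `<=` H `&` ~` K &
    inner_content (H `&` ~` K) <= (b W + e / 3)%:E].
  have [_ [L [cL LHK] <-]] :=
    ub_ereal_sup_adherent e30 (inner_content_fin oHK).
  rewrite -/(inner_content _) => hL.
  have [W [tW LW WHK]] := tight_between cL oHK LHK.
  exists W; split=> //.
  rewrite EFinD -leeBlDr//; apply: (le_trans (ltW hL)); rewrite lee_fin.
  by apply: le_content => //; case: (tW); auto.
have oW : open W by case: tW.
have h1 : outer_content (H `&` G) <= (b V + e / 3)%:E.
  by apply: le_trans iV; exact: outer_content_le_inner.
have h2 : outer_content (H `&` ~` G) <= (b W + e / 3)%:E.
  apply: le_trans iW; apply: outer_content_le_inner => //.
  by apply: setIS => x nGx /KV /VHG[].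
have h3 : (b V + b W <= b (V `|` W) + e / 3)%R.
  rewrite contentU; [|auto|auto]; rewrite lerD2l; apply: le_trans bK.
  apply: le_content; first by apply: measurableI; auto.
    by apply: measurableD; auto.
  by move=> x [Vx /WHK[_ nKx]].
have h4 : (b (V `|` W))%:E <= inner_content H.
  apply: tight_inner_content; first exact: tight_openU.
  by rewrite subUset; split=> x; [move=> /VHG[]|move=> /WHK[]].
apply: (le_trans (leeD h1 h2)).
apply: (@le_trans _ _ (b (V `|` W) + e)%:E); last by rewrite EFinD leeD.
rewrite -EFinD lee_fin; lra.
Qed.

Lemma open_caratheodory G : open G -> caratheodory_measurable outer_content G.
Proof.
move=> oG; apply: le_caratheodory_measurable => X.
apply/lee_addgt0Pr => e e0; have [H [oH XH hH]] := outer_content_approx X e0.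
apply: le_trans hH; apply: le_trans (inner_content_split oG oH).
by apply: leeD; apply: le_outer_content; exact: setSI.
Qed.

Lemma borel_caratheodory (A : set (borel Y)) : measurable A ->
  caratheodory_measurable outer_content A.
Proof.
apply: smallest_sub => //=; last exact: open_caratheodory.
split.
- exact: caratheodory_measurable_set0.
- by move=> B mB; rewrite setTD; exact: caratheodory_measurable_setC.
- by move=> F mF; exact: caratheodory_measurable_bigcup.
Qed.

(** The outer content again, now as a function on the Borel sets: this copy
    carries the measure structure. *)
Definition radon_extension (A : set (borel Y)) : \bar R := outer_content A.

Lemma radon_extension0 : radon_extension set0 = 0.
Proof. exact: outer_content0. Qed.

Lemma radon_extension_ge0 A : 0 <= radon_extension A.
Proof. exact: outer_content_ge0. Qed.

Lemma radon_extension_sigma_additive : semi_sigma_additive radon_extension.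
Proof.
move=> F mF tF mUF.
have mF' i : measurable (F i : set (caratheodory_type outer_content)).
  exact: borel_caratheodory.
have mUF' : measurable (\bigcup_i F i : set (caratheodory_type outer_content)).
  exact: borel_caratheodory.
exact: (@caratheodory_measure_sigma_additive _ _ outer_content) mF' tF mUF'.
Qed.

HB.instance Definition _ := isMeasure.Build _ _ _ radon_extension
  radon_extension0 radon_extension_ge0 radon_extension_sigma_additive.

Lemma radon_extension_fin : fin_num_fun radon_extension.
Proof. by move=> A _; exact: outer_content_fin. Qed.

HB.instance Definition _ := Measure_isFinite.Build _ _ _ radon_extension
  radon_extension_fin.

Lemma radon_extension_open_le (G : set Y) : open G ->
  radon_extension G <= (b G)%:E.
Proof.
move=> oG; rewrite /radon_extension outer_content_open//.
exact: inner_content_le.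
Qed.

Lemma radon_extension_tight (V : set Y) : tight_open V ->
  radon_extension V = (b V)%:E.
Proof.
move=> tV; rewrite /radon_extension outer_content_open; last by case: tV.
exact: inner_content_tight.
Qed.

(** Outer regularity applied to the complement gives inner approximation by
    closed sets, which are cut down to compact ones by tightness of the whole
    space. *)
Lemma radon_extension_radon : radon radon_extension.
Proof.
move=> B e mB e0; have e20 : (0 < e / 2)%R by rewrite divr_gt0.
have [_ tT] := tightT; have [K [cK _ bK]] := tT _ e20.
have [G [oG BG hG]] := outer_content_approx (~` B) e20.
have mG : measurable (G : set (borel Y)) by auto.
have mK : measurable (K : set (borel Y)) by auto.
exists (K `&` ~` G); split.
- by apply: compact_closedI => //; exact: open_closedC.
- by move=> x [_ nGx]; apply: contrapT => /BG.
have mBG : measurable ((G : set (borel Y)) `\` ~` B).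
  by apply: measurableD => //; exact: measurableC.
have mKC : measurable (~` K : set (borel Y)) by exact: measurableC.
apply: (@le_trans _ _ (radon_extension ((G `\` ~` B) `|` ~` K))).
  apply: le_outer_content => x [Bx nKG].
  have [Kx|nKx] := pselect (K x); last by right.
  left; split=> /=; last by apply.
  by apply: contrapT => nGx; apply: nKG.
apply: (@le_trans _ _ (radon_extension (G `\` ~` B) + radon_extension (~` K))).
  exact: measureU2.
rewrite [e]splitr EFinD; apply: leeD.
  rewrite measureD//; last 2 first.
    exact: measurableC.
    by rewrite (le_lt_trans (radon_extension_open_le oG))// ltry.
  rewrite setIidr// leeBlDr; last exact: outer_content_fin.
  rewrite addeC; apply: le_trans hG.
  by rewrite -outer_content_open.
have oKC : open (~` K) by apply: closed_openC; exact: compact_closed.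
apply: (le_trans (radon_extension_open_le oKC)).
by rewrite lee_fin -setTD.
Qed.

Lemma exists_radon_extension :
  exists gamma : {finite_measure set (borel Y) -> \bar R},
  [/\ radon gamma,
      forall G : set Y, open G -> gamma G <= (b G)%:E &
      forall V : set Y, tight_open V -> gamma V = (b V)%:E].
Proof.
exists (radon_extension : {finite_measure set (borel Y) -> \bar R}); split.
- exact: radon_extension_radon.
- exact: radon_extension_open_le.
- exact: radon_extension_tight.
Qed.

End content_extension.

(** * Couplings as limits of approximate couplings *)

Lemma borel_preimage (Y Z : ptopologicalType) (P : set Y) (f : Y -> Z) :
  measurable (P : set (borel Y)) ->
  (forall G, open G -> measurable (P `&` f @^-1` G : set (borel Y))) ->
  measurable_fun (P : set (borel Y)) (f : borel Y -> borel Z).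
Proof.
move=> mP h; apply: (@measurability _ _ (borel Y) (borel Z) P f (@open Z)) => //.
move=> _ [G oG <-].
exact: h.
Qed.

Lemma continuous_borel (Y Z : ptopologicalType) (f : Y -> Z) :
  continuous f -> measurable_fun setT (f : borel Y -> borel Z).
Proof.
move=> cf; apply: borel_preimage => // G oG.
by rewrite setTI; apply: open_borel; apply: open_comp.
Qed.

Lemma fst_borel (X Y : ptopologicalType) :
  measurable_fun setT (fst : borel (X * Y)%type -> borel X).
Proof. by apply: continuous_borel => x; exact: cvg_fst. Qed.

Lemma snd_borel (X Y : ptopologicalType) :
  measurable_fun setT (snd : borel (X * Y)%type -> borel Y).
Proof. by apply: continuous_borel => x; exact: cvg_snd. Qed.

Section finite_pushforward.
Context (R : realType) d1 d2 (T1 : measurableType d1) (T2 : measurableType d2).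
Variables (mu : {finite_measure set T1 -> \bar R}) (f : T1 -> T2).
Hypothesis mf : measurable_fun setT f.

(** The proof of measurability is an argument so that the measure structure
    can be inferred from the function. *)
Let image (_ : measurable_fun setT f) : set T2 -> \bar R := pushforward mu f.

Let image0 : image mf set0 = 0%E.
Proof. by rewrite /image /pushforward preimage_set0 measure0. Qed.

Let image_ge0 A : (0 <= image mf A)%E.
Proof. exact: measure_ge0. Qed.

Let image_sigma_additive : semi_sigma_additive (image mf).
Proof.
pose m := [the {measure set T2 -> \bar R} of pushforward mu f].
exact: (@measure_semi_sigma_additive _ _ _ (m mf)).
Qed.

HB.instance Definition _ := isMeasure.Build _ _ _ (image mf)
  image0 image_ge0 image_sigma_additive.

Let fin_num_image : fin_num_fun (image mf).
Proof.
move=> A mA; rewrite /image /pushforward fin_num_measure//.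
by rewrite -[_ @^-1` _]setTI; exact: mf.
Qed.

HB.instance Definition _ :=
  Measure_isFinite.Build _ _ _ (image mf) fin_num_image.

Lemma finite_pushforward : exists nu : {finite_measure set T2 -> \bar R},
  (nu : set T2 -> \bar R) = pushforward mu f.
Proof. by exists (image mf : {finite_measure set T2 -> \bar R}). Qed.

End finite_pushforward.

Lemma eq_measurable_open (R : realType) (X : ptopologicalType)
    (m1 m2 : {finite_measure set (borel X) -> \bar R}) :
  (forall G : set X, open G -> m1 G = m2 G) -> eq_measurable m1 m2.
Proof.
move=> h A mA.
apply: (@measure_unique _ R (borel X) (@open X) (fun=> setT)) => //.
- exact: openI.
- by move=> _; exact: openT.
- by rewrite bigcup_const.
- by move=> _; rewrite ltey_eq fin_num_measure.
Qed.

(** A finitely additive set function with Radon marginals extends to a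
    coupling: tightness of rectangles comes from the marginals alone. *)
Section coupling_of_content.
Context (R : realType) (X : ptopologicalType).
Variables mu1 mu2 : {finite_measure set (borel X) -> \bar R}.
Variable b : set (borel (X * X)%type) -> R.
Hypothesis hX : hausdorff_space X.
Hypotheses (rmu1 : radon mu1) (rmu2 : radon mu2).
Hypothesis b_ge0 : forall A, measurable A -> 0 <= b A.
Hypothesis b_add : forall A B, measurable A -> measurable B ->
  A `&` B = set0 -> b (A `|` B) = b A + b B.
Hypothesis b_fst : forall A : set (borel X), measurable A ->
  (b (fst @^-1` A))%:E = mu1 A.
Hypothesis b_snd : forall A : set (borel X), measurable A ->
  (b (snd @^-1` A))%:E = mu2 A.

Let mfst (A : set (borel X)) : measurable A ->
  measurable (fst @^-1` A : set (borel (X * X)%type)).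
Proof. by move=> mA; rewrite -[_ @^-1` _]setTI; exact: fst_borel. Qed.

Let msnd (A : set (borel X)) : measurable A ->
  measurable (snd @^-1` A : set (borel (X * X)%type)).
Proof. by move=> mA; rewrite -[_ @^-1` _]setTI; exact: snd_borel. Qed.

Lemma open_setX (A B : set X) : open A -> open B -> open (A `*` B).
Proof.
move=> oA oB; have -> : A `*` B = fst @^-1` A `&` snd @^-1` B by [].
by apply: openI; apply: open_comp => // x _; [exact: cvg_fst|exact: cvg_snd].
Qed.

Lemma tight_rectangle (A B : set X) : open A -> open B ->
  tight_open b (A `*` B).
Proof.
move=> oA oB; split=> [|e e0]; first exact: open_setX.
have e20 : 0 < e / 2 by rewrite divr_gt0.
have [K [cK KA bK]] := rmu1 (open_borel oA) e20.
have [L [cL LB bL]] := rmu2 (open_borel oB) e20.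
exists (K `*` L); split; first exact: compact_setX.
  by move=> [x y] [/= /KA ? /LB ?].
have mK : measurable (K : set (borel X)).
  by apply: closed_borel; exact: compact_closed.
have mL : measurable (L : set (borel X)).
  by apply: closed_borel; exact: compact_closed.
have mAK : measurable ((A : set (borel X)) `\` K).
  by apply: measurableD => //; exact: open_borel.
have mBL : measurable ((B : set (borel X)) `\` L).
  by apply: measurableD => //; exact: open_borel.
have mKL : measurable ((K `*` L) : set (borel (X * X)%type)).
  have -> : K `*` L = fst @^-1` K `&` snd @^-1` L by [].
  by apply: measurableI; [exact: mfst|exact: msnd].
apply: (@le_trans _ _ (b (fst @^-1` (A `\` K) `|` snd @^-1` (B `\` L)))).
  apply: (le_content b_ge0 b_add).
  - by apply: measurableD => //; apply: open_borel; exact: open_setX.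
  - by apply: measurableU; [exact: mfst|exact: msnd].
  - move=> [x y] [[/= Ax By] nKL].
    have [Kx|nKx] := pselect (K x); last by left.
    by right; split=> // Ly; apply: nKL.
apply: (le_trans (content_leU b_ge0 b_add (mfst mAK) (msnd mBL))).
by rewrite [e]splitr lerD// -lee_fin ?b_fst ?b_snd.
Qed.

Lemma exists_coupling_of_content : exists2 gamma, coupling mu1 mu2 gamma &
  forall G : set (X * X), open G -> (gamma G <= (b G)%:E)%E.
Proof.
have [|G [x y]||gamma [rg gle geq]] := @exists_radon_extension _ _ b _ b_ge0 b_add.
- exact: hausdorff_setX.
- rewrite openE => /[apply] -[[A B] /= [Ax By] ABG].
  exists (A° `*` B°); split.
  + by apply: tight_rectangle; exact: open_interior.
  + by split.
  + move=> [u v] [/= /interior_subset Au /interior_subset Bv].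
    exact: ABG.
- by rewrite -setXTT; apply: tight_rectangle; exact: openT.
have [nu1 nu1E] := finite_pushforward gamma (@fst_borel X X).
have [nu2 nu2E] := finite_pushforward gamma (@snd_borel X X).
exists gamma => //; split=> //.
- rewrite -nu1E; apply: eq_measurable_open => A oA.
  rewrite nu1E -b_fst; last exact: open_borel.
  rewrite /pushforward -setXT; apply: geq.
  by apply: tight_rectangle => //; exact: openT.
- rewrite -nu2E; apply: eq_measurable_open => A oA.
  rewrite nu2E -b_snd; last exact: open_borel.
  rewrite /pushforward -setTX; apply: geq.
  by apply: tight_rectangle => //; exact: openT.
Qed.

End coupling_of_content.

(** Compactness of approximate couplings.  Their setwise limit along an
    ultrafilter exists because the values stay in a compact interval; it is only
    finitely additive, but its marginals are Radon measures. *)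
Section asymptotic_coupling.
Context (R : realType) (X : ptopologicalType).
Variables mu1 mu2 : {finite_measure set (borel X) -> \bar R}.
Variable g : nat -> set (borel (X * X)%type) -> R.
Hypothesis hX : hausdorff_space X.
Hypotheses (rmu1 : radon mu1) (rmu2 : radon mu2).
Hypothesis g_ge0 : forall n A, measurable A -> 0 <= g n A.
Hypothesis g_add : forall n A B, measurable A -> measurable B ->
  A `&` B = set0 -> g n (A `|` B) = g n A + g n B.
Hypothesis g_fst : forall A : set (borel X), measurable A ->
  g n (fst @^-1` A) @[n --> \oo] --> fine (mu1 A).
Hypothesis g_snd : forall A : set (borel X), measurable A ->
  g n (snd @^-1` A) @[n --> \oo] --> fine (mu2 A).

Lemma ultra_cvg (U : set_system nat) (u : nat -> R) (M : R) :
  UltraFilter U -> \oo `<=` U ->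
  (\forall n \near \oo, 0 <= u n <= M) -> cvg (u @ U).
Proof.
move=> UU ooU uM.
have UI : UltraFilter (u @ U).
  split; first exact: fmap_proper_filter.
  move=> G GF sG; apply/seteqP; split=> [A GA|]; last exact: sG.
  have [//|UnA] := in_ultra_setVsetC (u @^-1` A) UU.
  have /filter_ex [? []] // : G (A `&` ~` A).
  by apply: filterI => //; apply: sG.
have cM : compact `[0, M] := @segment_compact R 0 M.
move: cM; rewrite compact_ultra => /(_ (u @ U) UI)[|x [_ ux]].
  apply: (ooU (u @^-1` _)); apply: filterS uM => n.
  by rewrite /= in_itv.
by apply/cvg_ex; exists x.
Qed.

(** The second conclusion is lower semicontinuity on open sets, in the form of
    a bound on finite sums.  Keeping the sums inside hides the ultrafilter:
    limits along it add up, whereas lower limits along the sequence do not. *)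
Lemma exists_asymptotic_coupling : exists2 gamma, coupling mu1 mu2 gamma &
  forall N (G : nat -> set (X * X)) (C : R), (forall k, open (G k)) ->
    (\forall n \near \oo, \sum_(k < N) g n (G k) <= C) ->
    (\sum_(k < N) gamma (G k) <= C%:E)%E.
Proof.
have [U [UU ooU]] := @ultraFilterLemma nat \oo _.
have mTT : measurable (setT : set (borel (X * X)%type)) by [].
have gC n A : measurable A -> g n A <= g n setT.
  by move=> mA; apply: (le_content (g_ge0 n) (@g_add n)).
pose M := fine (mu1 setT) + 1.
have gcvg A : measurable A -> cvg (g n A @[n --> U]).
  move=> mA; apply: (@ultra_cvg U _ M) => //.
  have := @g_fst setT measurableT; rewrite preimage_setT.
  move=> /cvgr_le /(_ M); rewrite ltrDl => /(_ ltr01) h.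
  near=> n; rewrite g_ge0//= (le_trans (gC _ _ _))//.
  by near: n; exact: h.
pose b A := lim (g n A @[n --> U]).
have bE A l : g n A @[n --> \oo] --> l -> b A = l.
  by move=> gl; apply/cvg_lim => //; apply: cvg_trans gl; apply: cvg_app.
have [||A mA|A mA|gamma cg gle] := @exists_coupling_of_content _ _ mu1 mu2 b hX rmu1 rmu2.
- move=> A mA; apply: limr_ge; first exact: gcvg.
  by apply: nearW => n; exact: g_ge0.
- move=> A B mA mB AB; apply/cvg_lim => //.
  under eq_fun do rewrite g_add//.
  by apply: cvgD; exact: gcvg.
- by rewrite (bE _ _ (g_fst mA)) fineK// fin_num_measure.
- by rewrite (bE _ _ (g_snd mA)) fineK// fin_num_measure.
exists gamma => // N G C oG gC'.
apply: (@le_trans _ _ (\sum_(k < N) b (G k))%:E).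
  by rewrite -sumEFin; apply: lee_sum => k _; exact: gle.
have bcvg : \sum_(k < N) g n (G k) @[n --> U] --> \sum_(k < N) b (G k).
  apply: cvg_big => [|k _]; first exact: add_continuous.
  by apply: gcvg; exact: open_borel.
rewrite lee_fin -(cvg_lim _ bcvg)//; apply: limr_le.
  by apply/cvg_ex; eexists; exact: bcvg.
exact: ooU.
Unshelve. all: by end_near. Qed.

End asymptotic_coupling.

(** * Integral comparison through simple functions *)

(** The integral of a nonnegative function is the supremum of the integrals of
    the simple functions below it.  The comparisons below follow from this
    directly, and so apply to the cone cost as it stands. *)
Section nonmeasurable_integral.
Context d (T : measurableType d) (R : realType).
Implicit Types (mu : {measure set T -> \bar R}) (f : T -> \bar R).
Import HBNNSimple.
Local Open Scope ereal_scope.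

Lemma ge0_integral_le mu f (C : \bar R) : (forall x, 0 <= f x) ->
  (forall h : {nnsfun T >-> R}, (forall x, (h x)%:E <= f x) ->
    \int[mu]_x (h x)%:E <= C) ->
  \int[mu]_x f x <= C.
Proof.
move=> f0 hC; rewrite ge0_integralTE//; apply: ge_ereal_sup => _ [h hf <-].
by rewrite -integralT_nnsfun; exact: hC.
Qed.

Lemma nnsfun_le_integral mu f (h : {nnsfun T >-> R}) : (forall x, 0 <= f x) ->
  (forall x, (h x)%:E <= f x) -> \int[mu]_x (h x)%:E <= \int[mu]_x f x.
Proof.
move=> f0 hf; rewrite integralT_nnsfun ge0_integralTE//.
by apply: ereal_sup_ubound; exists h.
Qed.

Lemma le_integralT mu f g : (forall x, 0 <= f x) -> (forall x, f x <= g x) ->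
  \int[mu]_x f x <= \int[mu]_x g x.
Proof.
move=> f0 fg; apply: ge0_integral_le => // h hf; apply: nnsfun_le_integral.
  by move=> x; exact: le_trans (fg x).
by move=> x; exact: le_trans (fg x).
Qed.

Lemma integralZl_le mu f (k : R) : (0 < k)%R -> (forall x, 0 <= f x) ->
  \int[mu]_x (k%:E * f x) <= k%:E * \int[mu]_x f x.
Proof.
move=> k0 f0; have k0' : (0 <= k^-1)%R by rewrite invr_ge0 ltW.
apply: ge0_integral_le => [x|h hf]; first by rewrite mule_ge0// lee_fin ltW.
have -> : \int[mu]_x (h x)%:E = k%:E * \int[mu]_x (scale_nnsfun h k0' x)%:E.
  rewrite -ge0_integralZl_EFin//.
  - apply: eq_integral => x _ /=.
    by rewrite -EFinM mulrA divff ?mul1r// gt_eqF.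
  - by move=> x _; rewrite lee_fin.
  - exact/measurable_EFinP.
  - exact: ltW.
rewrite lee_pmul2l ?lte_fin//; apply: nnsfun_le_integral => // x /=.
by rewrite -(@lee_pmul2l _ k%:E) ?lte_fin// -EFinM mulVKf ?gt_eqF.
Qed.

(** One inequality applied to [k] and to its inverse. *)
Lemma integralZl_pos mu f (k : R) : (0 < k)%R -> (forall x, 0 <= f x) ->
  \int[mu]_x (k%:E * f x) = k%:E * \int[mu]_x f x.
Proof.
move=> k0 f0; apply/eqP; rewrite eq_le integralZl_le//=.
have k0' : (0 < k^-1)%R by rewrite invr_gt0.
rewrite -(@lee_pmul2l _ (k^-1)%:E) ?lte_fin//.
rewrite muleA -EFinM mulVf ?gt_eqF// mul1e.
apply: le_trans (integralZl_le _ k0' _); last first.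
  by move=> x; rewrite mule_ge0// lee_fin ltW.
apply: le_integralT => // x.
by rewrite muleA -EFinM mulVf ?gt_eqF// mul1e.
Qed.

End nonmeasurable_integral.

Section pushforward_le.
Context (R : realType) d1 d2 (T1 : measurableType d1) (T2 : measurableType d2).
Import HBNNSimple.
Local Open Scope ereal_scope.

Lemma integral_pushforward_le (mu : {measure set T1 -> \bar R})
    (nu : {measure set T2 -> \bar R}) (phi : T1 -> T2) (f : T2 -> \bar R) :
  measurable_fun setT phi -> (nu : set T2 -> \bar R) = pushforward mu phi ->
  (forall x, 0 <= f x) -> \int[nu]_x f x <= \int[mu]_x f (phi x).
Proof.
move=> mphi nuE f0; apply: ge0_integral_le => // h hf.
rewrite nuE ge0_integral_pushforward//; first 1 last.
- exact/measurable_EFinP.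
- by move=> x _; rewrite lee_fin.
by rewrite preimage_setT; apply: le_integralT => x /=; rewrite ?lee_fin.
Qed.

End pushforward_le.

(** * The angular part of the cone distance *)

Section trigonometry.
Context (R : realType).
Implicit Types (s c t : R).

Lemma sin_MVT (a b : R) : a <= b ->
  exists2 x, a <= x <= b & sin b - sin a = cos x * (b - a).
Proof.
move=> ab; have [|x xab sinE] := @MVT_segment R sin cos a b ab.
- by apply: continuous_subspaceT; exact: continuous_sin.
- by rewrite in_itv/= in xab; exists x.
Qed.

Lemma ler_cos_0pi (a b : R) : 0 <= a -> a <= b -> b <= pi -> cos b <= cos a.
Proof.
move=> a0 ab bpi.
have [aI bI] : a \in `[0, pi] /\ b \in `[0, pi].
  by rewrite !in_itv/= a0 bpi (le_trans ab) ?(le_trans a0).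
by rewrite leNgt ltr_cos// -leNgt.
Qed.

Lemma ler_sin_0pihalf (a b : R) : 0 <= a -> a <= b -> b <= pi / 2 ->
  sin a <= sin b.
Proof.
move=> a0 ab bpi; have pi0 : 0 <= pi / 2 :> R by rewrite divr_ge0// pi_ge0.
have [aI bI] : a \in `[- (pi / 2), pi / 2] /\ b \in `[- (pi / 2), pi / 2].
  rewrite !in_itv/= bpi (le_trans ab bpi) !andbT.
  by rewrite (le_trans _ a0) ?(le_trans _ (le_trans a0 ab)) ?oppr_le0.
by rewrite leNgt ltr_sin// -leNgt.
Qed.

Lemma sin_le_id s : 0 <= s -> sin s <= s.
Proof.
move=> s0; have [x _] := sin_MVT s0; rewrite sin0 !subr0 => ->.
by rewrite ler_piMl// cos_le1.
Qed.

Lemma mul_cos_le_sin s : 0 <= s -> s <= pi -> s * cos s <= sin s.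
Proof.
move=> s0 spi; have [x /andP[x0 xs]] := sin_MVT s0; rewrite sin0 !subr0 => ->.
by rewrite mulrC ler_wpM2r// ler_cos_0pi.
Qed.

(** Concavity of the sine on [0, pi], from the mean value theorem on [0, c s]
    and on [c s, s] together with the monotonicity of the cosine. *)
Lemma mul_sin_le c s : 0 <= c -> c <= 1 -> 0 <= s -> s <= pi ->
  c * sin s <= sin (c * s).
Proof.
move=> c0 c1 s0 spi.
have cs0 : 0 <= c * s by rewrite mulr_ge0.
have css : c * s <= s by rewrite ler_piMl.
have [x /andP[x0 xcs]] := sin_MVT cs0; rewrite sin0 !subr0 => sincs.
have [y /andP[csy ys] sins] := sin_MVT css.
have cxy : cos y <= cos x.
  by apply: ler_cos_0pi => //; [exact: le_trans csy|exact: le_trans spi].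
have h : c * (s - c * s) * (cos x - cos y) >= 0.
  by rewrite !mulr_ge0// subr_ge0.
rewrite -subr_ge0; apply: le_trans h _.
have -> : sin s = sin (c * s) + cos y * (s - c * s) by rewrite -sins; ring.
rewrite sincs; lra.
Qed.

End trigonometry.

Section cone_angle.
Context (R : realType).
Implicit Types (l T : R) (D : \bar R).

Definition cone_angle l D : R := fine (Order.min ((l^-1)%:E * D)%E pi%:E).

Lemma cone_angle_fin l (r : R) : cone_angle l r%:E = Num.min (r / l) pi.
Proof. by rewrite /cone_angle -EFinM -EFin_min mulrC. Qed.

Lemma cone_angle_pinfty l : 0 < l -> cone_angle l +oo%E = pi.
Proof. by move=> l0; rewrite /cone_angle gt0_muley ?lte_fin ?invr_gt0// minye. Qed.

Lemma cone_angle_bounds l D : 0 < l -> (0 <= D)%E -> 0 <= cone_angle l D <= pi.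
Proof.
move=> l0; case: D => [r|_|] //; [rewrite lee_fin => r0|].
  rewrite cone_angle_fin le_min pi_ge0 andbT ge_min lexx orbT andbT.
  by rewrite divr_ge0// ltW.
by rewrite cone_angle_pinfty// pi_ge0 lexx.
Qed.

Lemma half_angle_bounds l D : 0 < l -> (0 <= D)%E ->
  0 <= cone_angle l D / 2 <= pi / 2.
Proof.
move=> l0 D0; have /andP[h1 h2] := cone_angle_bounds l0 D0.
by rewrite divr_ge0//= ler_pM2r.
Qed.

Lemma sin_half_angle_ge0 l D : 0 < l -> (0 <= D)%E ->
  0 <= sin (cone_angle l D / 2).
Proof.
move=> l0 D0; have /andP[h1 h2] := half_angle_bounds l0 D0.
apply: sin_ge0_pi; rewrite h1 (le_trans h2)//.
by rewrite ler_pdivrMr// ler_peMr ?pi_ge0// ler1n.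
Qed.

(** Multiplying the length scale by 1 / c divides the angle by at most that
    factor, and [mul_sin_le] compares the two sines. *)
Lemma chord_monotone l1 l2 D : 0 < l1 -> l1 <= l2 -> (0 <= D)%E ->
  l1 * sin (cone_angle l1 D / 2) <= l2 * sin (cone_angle l2 D / 2).
Proof.
move=> l10 l12 D0; have l20 := lt_le_trans l10 l12.
pose c := l1 / l2.
have c0 : 0 <= c by rewrite divr_ge0// ltW.
have c1 : c <= 1 by rewrite ler_pdivrMr// mul1r.
have /andP[a0 a1] := half_angle_bounds l10 D0.
have /andP[b0 b1] := half_angle_bounds l20 D0.
have cth : c * (cone_angle l1 D / 2) <= cone_angle l2 D / 2.
  rewrite mulrA ler_pM2r//.
  case: D D0 {a0 a1 b0 b1} => [r|_|] //; [rewrite lee_fin => r0|].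
    rewrite !cone_angle_fin le_min; apply/andP; split.
      apply: (@le_trans _ _ (c * (r / l1))).
        by rewrite ler_wpM2l// ge_min lexx.
      by rewrite /c le_eqVlt; apply/orP; left; apply/eqP; field; rewrite !gt_eqF.
    apply: (@le_trans _ _ (1 * pi)); last by rewrite mul1r.
    apply: ler_pM => //; last by rewrite ge_min lexx orbT.
    by rewrite le_min pi_ge0 divr_ge0// ltW.
  by rewrite !cone_angle_pinfty// ler_piMl// pi_ge0.
have -> : l1 = l2 * c by rewrite /c; field; rewrite gt_eqF.
rewrite -/c -mulrA ler_pM2l//.
apply: (@le_trans _ _ (sin (c * (cone_angle l1 D / 2)))).
  have -> : l2 * c = l1 by rewrite /c; field; rewrite gt_eqF.
  apply: mul_sin_le => //; apply: (le_trans a1).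
  by rewrite ler_pdivrMr// ler_peMr ?pi_ge0// ler1n.
by apply: ler_sin_0pihalf => //; rewrite mulr_ge0.
Qed.

Lemma chord_le_dist l D : 0 < l -> (0 <= D)%E ->
  ((l ^+ 2 * (4 * sin (cone_angle l D / 2) ^+ 2))%:E <= D ^+ 2)%E.
Proof.
move=> l0 D0; have /andP[a0 a1] := half_angle_bounds l0 D0.
have s0 := sin_half_angle_ge0 l0 D0.
case: D D0 a0 a1 s0 => [r|_|] //; last first.
  move=> a0 a1 s0.
  by rewrite expe2 mulyy leey.
rewrite lee_fin => r0 a0 a1 s0; rewrite -EFin_expe lee_fin.
have h : l * (2 * sin (cone_angle l r%:E / 2)) <= r.
  rewrite -ler_pdivlMl// -ler_pdivlMl//.
  apply: (le_trans (sin_le_id a0)).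
  by rewrite mulrC ler_pM2l// cone_angle_fin ge_min mulrC lexx.
have -> : l ^+ 2 * (4 * sin (cone_angle l r%:E / 2) ^+ 2) =
  (l * (2 * sin (cone_angle l r%:E / 2))) ^+ 2 by ring.
by rewrite lerXn2r// nnegrE// !mulr_ge0// ltW.
Qed.

(** A quantitative form of the convergence of l^2 4 sin^2(d / (2 l)) to d^2,
    uniform on the set where d is at most [T]; it rests on
    s cos s <= sin s. *)
Lemma truncated_dist_le_chord l D T : 0 < T -> T <= l * pi -> 0 < l ->
  (0 <= D)%E -> (fine (Order.min D T%:E)) ^+ 2 * cos (T / (2 * l)) ^+ 2 <=
    l ^+ 2 * (4 * sin (cone_angle l D / 2) ^+ 2).
Proof.
move=> T0 Tl l0 D0; set t := fine _.
have /andP[t0 tT] : 0 <= t <= T.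
  rewrite /t {t}; case: D D0 => [r|_|] //; [rewrite lee_fin => r0|].
    by rewrite -EFin_min/= le_min r0 ltW//= ge_min lexx orbT.
  by rewrite minye /= lexx ltW.
have /andP[a0 a1] := half_angle_bounds l0 D0.
have s0 := sin_half_angle_ge0 l0 D0.
have pi20 : (0 : R) < pi / 2 by rewrite divr_gt0// pi_gt0.
have T2l : T / (2 * l) <= pi / 2.
  by rewrite invfM mulrCA mulrC ler_pM2r// ler_pdivrMr// mulrC.
have t2l : t / (2 * l) <= T / (2 * l) by rewrite ler_pM2r// invr_gt0 mulr_gt0.
have t2l0 : 0 <= t / (2 * l) by rewrite divr_ge0// mulr_ge0// ltW.
have c0 : 0 <= cos (T / (2 * l)).
  apply: cos_ge0_pihalf; rewrite T2l andbT.
  by rewrite (le_trans _ (le_trans t2l0 t2l))// oppr_le0 ltW.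
have ta : t / (2 * l) <= cone_angle l D / 2.
  rewrite invfM mulrCA mulrC ler_pM2r//.
  rewrite /t {t0 tT t2l t2l0 a0 a1 s0 t}; case: D D0 => [r|_|] //;
    [rewrite lee_fin => r0|].
    rewrite -EFin_min/= cone_angle_fin le_min; apply/andP; split.
      by rewrite ler_pM2r ?invr_gt0// ge_min lexx.
    rewrite ler_pdivrMr// mulrC (le_trans _ Tl)//.
    by rewrite ge_min lexx orbT.
  by rewrite minye/= cone_angle_pinfty// ler_pdivrMr// mulrC.
have h : t * cos (T / (2 * l)) <= l * (2 * sin (cone_angle l D / 2)).
  have -> : t * cos (T / (2 * l)) =
      l * (2 * ((t / (2 * l)) * cos (T / (2 * l)))).
    by field; rewrite gt_eqF.
  rewrite ler_pM2l// ler_pM2l//.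
  have pihpi : pi / 2 <= pi :> R.
    by rewrite ler_pdivrMr// ler_peMr ?pi_ge0// ler1n.
  apply: (@le_trans _ _ (t / (2 * l) * cos (t / (2 * l)))).
    by rewrite ler_wpM2l// ler_cos_0pi// (le_trans T2l).
  apply: (@le_trans _ _ (sin (t / (2 * l)))).
    by apply: mul_cos_le_sin => //; rewrite (le_trans t2l)// (le_trans T2l).
  exact: ler_sin_0pihalf.
have -> : t ^+ 2 * cos (T / (2 * l)) ^+ 2 = (t * cos (T / (2 * l))) ^+ 2 by ring.
have -> : l ^+ 2 * (4 * sin (cone_angle l D / 2) ^+ 2) =
  (l * (2 * sin (cone_angle l D / 2))) ^+ 2 by ring.
by rewrite lerXn2r// nnegrE !mulr_ge0// ltW.
Qed.

End cone_angle.

Section cone_dist.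
Context (R : realType) (X : ptopologicalType) (d : X -> X -> \bar R).
Local Notation C := (cone R X).
Implicit Types (z : C) (l : R).

Lemma cone_r_ge0 z : 0 <= cone_r z.
Proof. by rewrite /cone_r; have := valP (repr z).2; rewrite inE. Qed.

(** Half-angle form, which separates the radial cost from the angular one. *)
Lemma cone_dist2E l z1 z2 : cone_dist2 (scale_dist l d) z1 z2 =
  (cone_r z1 - cone_r z2) ^+ 2 + cone_r z1 * cone_r z2 *
    (4 * sin (cone_angle l (d (repr z1).1 (repr z2).1) / 2) ^+ 2).
Proof.
rewrite /cone_dist2 /scale_dist -/(cone_angle l _).
set a := cone_angle _ _.
have -> : cos a = 1 - 2 * sin (a / 2) ^+ 2.
  have -> : cos a = cos ((a / 2) *+ 2) by rewrite -[_ *+ 2]mulr_natr divfK.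
  by rewrite cos_mulr2n cos2sin2; ring.
by ring.
Qed.

Hypothesis d_ge0 : forall x y, (0 <= d x y)%E.

Lemma cone_dist2_ge0 l z1 z2 : 0 <= cone_dist2 (scale_dist l d) z1 z2.
Proof.
rewrite cone_dist2E; apply: addr_ge0; first exact: sqr_ge0.
apply: mulr_ge0; first by rewrite mulr_ge0 ?cone_r_ge0.
by rewrite pmulr_rge0 ?sqr_ge0.
Qed.

Lemma cone_dist2_monotone l1 l2 z1 z2 : 0 < l1 -> l1 <= l2 ->
  l1 ^+ 2 * cone_dist2 (scale_dist l1 d) z1 z2 <=
  l2 ^+ 2 * cone_dist2 (scale_dist l2 d) z1 z2.
Proof.
move=> l10 l12; have l20 := lt_le_trans l10 l12.
rewrite !cone_dist2E !mulrDr; apply: lerD.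
  by rewrite ler_wpM2r ?sqr_ge0// lerXn2r// nnegrE ltW.
have h := chord_monotone l10 l12 (d_ge0 (repr z1).1 (repr z2).1).
rewrite mulrCA [leRHS]mulrCA; apply: ler_wpM2l.
  by rewrite mulr_ge0 ?cone_r_ge0.
rewrite mulrCA [leRHS]mulrCA ler_pM2l// -!exprMn lerXn2r//.
  by rewrite nnegrE mulr_ge0 ?sin_half_angle_ge0// ltW.
by rewrite nnegrE mulr_ge0 ?sin_half_angle_ge0// ltW.
Qed.

End cone_dist.

(** * Measurability on the cone *)

Lemma continuous_borel_real (R : realType) (Y : ptopologicalType) (f : Y -> R) :
  continuous f -> measurable_fun setT (f : borel Y -> R).
Proof.
move=> cf; apply: (measurability _ (RGenOInfty.measurableE R)).
move=> _ [_ [a ->] <-]; rewrite setTI; apply: open_borel.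
by apply: open_comp => //; exact: interval_open.
Qed.

Lemma continuous_pair (T U V : topologicalType) (f : T -> U) (g : T -> V) :
  continuous f -> continuous g -> continuous (fun x => (f x, g x)).
Proof.
move=> cf cg x; apply: (@cvg_pair _ _ _ _ (nbhs (f x)) (nbhs (g x))).
  exact: cf.
exact: cg.
Qed.

Section cone_topology.
Local Open Scope quotient_scope.
Context (R : realType) (X : ptopologicalType).
Local Notation C := (cone R X).
Implicit Types (z : C).

Lemma open_val_snd (V : set R) : open V ->
  open [set p : X * halfline R | V (\val p.2)].
Proof.
move=> oV; have -> : [set p : X * halfline R | V (\val p.2)] =
  (fun p : X * halfline R => set_val p.2) @^-1` V by [].
apply: open_comp => // p _; apply: (@continuous_comp _ _ _ snd set_val).
  exact: cvg_snd.
exact: initial_continuous.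
Qed.

Lemma continuous_cone_r : continuous (@cone_r R X).
Proof.
apply/continuousP => V oV; split.
  rewrite (_ : [set p | _] =
      [set p : X * halfline R | (V `&` [set r | 0 < r]) (\val p.2)]).
    by apply: open_val_snd; apply: openI => //; exact: open_gt.
  by apply/seteqP; split=> p /=; rewrite cone_r_pi => -[].
rewrite /= /vertex cone_r_pi /= => V0.
have [e /= e0 eV] : nbhs (0 : R) V by exact: open_nbhs_nbhs.
exists e => // z /= ze; apply: eV => /=.
by rewrite sub0r normrN ger0_norm// cone_r_ge0.
Qed.

Lemma open_cone_x (G : set X) : open G ->
  open [set z : C | 0 < cone_r z /\ G (cone_x z)].
Proof.
move=> oG; split; last by rewrite /= /vertex cone_r_pi /= ltxx => -[].
rewrite (_ : [set p | _] = fst @^-1` G `&`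
    [set p : X * halfline R | [set r | 0 < r] (\val p.2)]).
  apply: openI; last by apply: open_val_snd; exact: open_gt.
  by apply: open_comp => // p _; exact: cvg_fst.
apply/seteqP; split=> p /=.
  by move=> [p0 [_]]; rewrite cone_x_pi.
by move=> [Gp p0]; rewrite cone_r_pi cone_x_pi.
Qed.

(** The base point is continuous away from the vertex and constant at it. *)
Lemma measurable_cone_x :
  measurable_fun setT (@cone_x R X : borel C -> borel X).
Proof.
pose P : set (borel C) := [set z | 0 < cone_r z].
have mP : measurable P.
  apply: open_borel; have -> : P = @cone_r R X @^-1` [set r | 0 < r] by [].
  by apply: open_comp; [move=> z _; exact: continuous_cone_r|exact: open_gt].
rewrite -(setUv P); apply/measurable_funU => //; first exact: measurableC.
split.
  apply: borel_preimage => // G oG.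
  by apply: open_borel; exact: open_cone_x.
apply: (@eq_measurable_fun _ _ (borel C) (borel X) _ (cst point)) => //.
by move=> z; rewrite inE /P /= => /negP z0; rewrite /cone_x (negbTE z0).
Qed.

Definition unit_radius : halfline R := exist _ 1 (mem_set (@ler01 R)).

Definition cone_lift (x : X) : C := \pi_(cone R X) (x, unit_radius).

Lemma cone_r_lift x : cone_r (cone_lift x) = 1.
Proof. by rewrite /cone_lift cone_r_pi. Qed.

Lemma cone_x_lift x : cone_x (cone_lift x) = x.
Proof. by rewrite /cone_lift cone_x_pi. Qed.

Lemma continuous_cone_lift : continuous cone_lift.
Proof.
apply/continuousP => U [oU _].
rewrite (_ : _ @^-1` _ = (fun x : X => (x, unit_radius)) @^-1`
    [set p : X * halfline R | 0 < \val p.2 /\ U (\pi_(cone R X) p)]).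
  apply: open_comp => // x _.
  by apply: continuous_pair => y; [exact: cvg_id|exact: cvg_cst].
by apply/seteqP; split=> x /=; [move=> Ux; split=> //|move=> []].
Qed.

Lemma repr_cone_x z : 0 < cone_r z -> (repr z).1 = cone_x z.
Proof. by rewrite /cone_x => ->. Qed.

End cone_topology.

Section cone_pairs.
Context (R : realType) (X : ptopologicalType).
Local Notation C := (cone R X).
Local Notation CC := (borel (C * C)%type).

Lemma measurable_cone_r1 : measurable_fun setT ((fun z => cone_r z.1) : CC -> R).
Proof.
apply: continuous_borel_real => z.
apply: (@continuous_comp _ _ _ fst (@cone_r R X)); first exact: cvg_fst.
exact: continuous_cone_r.
Qed.

Lemma measurable_cone_r2 : measurable_fun setT ((fun z => cone_r z.2) : CC -> R).
Proof.
apply: continuous_borel_real => z.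
apply: (@continuous_comp _ _ _ snd (@cone_r R X)); first exact: cvg_snd.
exact: continuous_cone_r.
Qed.

Lemma measurable_cone_x1 :
  measurable_fun setT ((fun z => cone_x z.1) : CC -> borel X).
Proof. exact: (measurableT_comp (@measurable_cone_x R X) (@fst_borel C C)). Qed.

Lemma measurable_cone_x2 :
  measurable_fun setT ((fun z => cone_x z.2) : CC -> borel X).
Proof. exact: (measurableT_comp (@measurable_cone_x R X) (@snd_borel C C)). Qed.

Definition base_points (z : C * C) : X * X := (cone_x z.1, cone_x z.2).

Definition positive_radii : set (C * C) :=
  [set z | 0 < cone_r z.1 /\ 0 < cone_r z.2].

(** Positivity of both radii is what makes the base points continuous: at the
    vertex the base point is a convention. *)
Lemma open_preimage_base_points (G : set (X * X)) : open G ->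
  open (positive_radii `&` base_points @^-1` G).
Proof.
move=> oG; rewrite openE => -[z1 z2] [[/= r1 r2]].
move: oG; rewrite openE => /[apply] -[[A B] /= [Ax Bx] ABG].
exists ([set z : C | 0 < cone_r z /\ A° (cone_x z)],
        [set z : C | 0 < cone_r z /\ B° (cone_x z)]) => /=.
  by split; apply: open_nbhs_nbhs; split=> //; apply: open_cone_x;
    exact: open_interior.
move=> [w1 w2] /= [[s1 A1] [s2 B2]]; split; first by split.
by apply: ABG; split; exact: interior_subset.
Qed.

Lemma measurable_base_points :
  measurable_fun (positive_radii : set CC) (base_points : CC -> borel (X * X)%type).
Proof.
apply: borel_preimage => [|G oG].
  rewrite -[X in measurable X](setIT positive_radii) -(preimage_setT base_points).
  by apply: open_borel; apply: open_preimage_base_points; exact: openT.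
by apply: open_borel; exact: open_preimage_base_points.
Qed.

Lemma measurable_positive_radii : measurable (positive_radii : set CC).
Proof.
rewrite -[X in measurable X](setIT positive_radii) -(preimage_setT base_points).
by apply: open_borel; apply: open_preimage_base_points; exact: openT.
Qed.

End cone_pairs.

(** * From couplings to plans *)

Section plan_of_coupling.
Context (R : realType) (X : ptopologicalType) (d : X -> X -> \bar R).
Hypothesis d_ge0 : forall x y, (0 <= d x y)%E.
Variables mu1 mu2 : {finite_measure set (borel X) -> \bar R}.
Local Notation C := (cone R X).
Local Notation CC := (borel (C * C)%type).

Let lift (p : X * X) : C * C := (cone_lift R p.1, cone_lift R p.2).

Let continuous_lift : continuous lift.
Proof.
apply: continuous_pair => p.
  apply: (@continuous_comp _ _ _ fst (@cone_lift R X)); first exact: cvg_fst.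
  exact: continuous_cone_lift.
apply: (@continuous_comp _ _ _ snd (@cone_lift R X)); first exact: cvg_snd.
exact: continuous_cone_lift.
Qed.

Let lift_inj : injective lift.
Proof.
move=> [x y] [x' y'] [/(congr1 (@cone_x R X))].
by rewrite !cone_x_lift => -> /(congr1 (@cone_x R X)); rewrite !cone_x_lift => ->.
Qed.

(** One plan serves all scales: the image of the coupling in the slice of
    radius 1, where the cone distance is the chord of the cone angle. *)
Lemma plan_of_coupling gamma : coupling mu1 mu2 gamma ->
  exists2 alpha, hk_plan (X := X) mu1 mu2 alpha & forall l : R, 0 < l ->
    ((l ^+ 2)%:E * \int[alpha]_z (cone_dist2 (scale_dist l d) z.1 z.2)%:E <=
     \int[gamma]_p (d p.1 p.2 ^+ 2))%E.
Proof.
move=> [rgamma gamma1 gamma2].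
have mlift : measurable_fun setT (lift : borel (X * X)%type -> CC).
  exact: continuous_borel.
have [alpha alphaE] := finite_pushforward gamma mlift.
have mr1 := @measurable_cone_r1 R X; have mr2 := @measurable_cone_r2 R X.
exists alpha; first split.
- move=> B e mB e0.
  have mlB : measurable (lift @^-1` B : set (borel (X * X)%type)).
    by rewrite -[_ @^-1` _]setTI; exact: mlift.
  have [K [cK KB gK]] := rgamma _ _ mlB e0.
  exists (lift @` K); split.
  + by apply: continuous_compact => //; exact: continuous_subspaceT.
  + by move=> _ [p Kp <-]; exact: KB.
  suff : (alpha (B `\` lift @` K) <= e%:E)%E by [].
  rewrite alphaE /pushforward.
  rewrite (_ : lift @^-1` (B `\` lift @` K) = lift @^-1` B `\` K)//.
  apply/seteqP; split=> p [Bp nKp]; split=> //.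
  by move=> [q Kq /lift_inj qp]; apply: nKp; rewrite -qp.
- apply: (@le_lt_trans _ _ (\int[gamma]_p (cst 2%:E p))%E); last first.
    by rewrite integral_cst// ltey_eq fin_numM// fin_num_measure.
  apply: (le_trans (integral_pushforward_le mlift alphaE _)).
    by move=> z; rewrite lee_fin addr_ge0 ?sqr_ge0.
  by under eq_integral do rewrite /= !cone_r_lift expr1n.
- move=> A mA; rewrite -(gamma1 A mA) /hmarginal /pushforward alphaE.
  rewrite ge0_integral_pushforward//=.
  + under eq_integral do rewrite /= cone_r_lift expr1n.
    rewrite (_ : _ @^-1` _ = (fst @^-1` A : set (borel (X * X)%type))).
      rewrite integral_cst ?mul1e//.
      by rewrite -[_ @^-1` _]setTI; exact: fst_borel.
    by apply/seteqP; split=> p /=; rewrite cone_x_lift.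
  + by rewrite -[_ @^-1` _]setTI; exact: measurable_cone_x1.
  + apply/measurable_EFinP; apply: measurable_funTS.
    exact: measurable_funX.
  + by move=> z _; rewrite lee_fin sqr_ge0.
- move=> A mA; rewrite -(gamma2 A mA) /hmarginal /pushforward alphaE.
  rewrite ge0_integral_pushforward//=.
  + under eq_integral do rewrite /= cone_r_lift expr1n.
    rewrite (_ : _ @^-1` _ = (snd @^-1` A : set (borel (X * X)%type))).
      rewrite integral_cst ?mul1e//.
      by rewrite -[_ @^-1` _]setTI; exact: snd_borel.
    by apply/seteqP; split=> p /=; rewrite cone_x_lift.
  + by rewrite -[_ @^-1` _]setTI; exact: measurable_cone_x2.
  + apply/measurable_EFinP; apply: measurable_funTS.
    exact: measurable_funX.
  + by move=> z _; rewrite lee_fin sqr_ge0.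
move=> l l0.
have l20 : 0 < l ^+ 2 by rewrite exprn_gt0.
rewrite -integralZl_pos//; last by move=> z; rewrite lee_fin cone_dist2_ge0.
apply: (le_trans (integral_pushforward_le mlift alphaE _)).
  by move=> z; rewrite mule_ge0// lee_fin ?cone_dist2_ge0// ltW.
apply: le_integralT => p; first by rewrite mule_ge0// lee_fin ?cone_dist2_ge0// ltW.
rewrite /= cone_dist2E !cone_r_lift subrr expr0n/= add0r !mul1r.
by rewrite !repr_cone_x ?cone_r_lift// !cone_x_lift -EFinM chord_le_dist.
Qed.

End plan_of_coupling.

(** * From plans to partial couplings *)

Section mass_deficit.
Context dT (T : measurableType dT) (R : realType).
Variables (mu : {measure set T -> \bar R}) (a b : T -> R) (A : set T).
Hypotheses (ma : measurable_fun setT a) (mb : measurable_fun setT b).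
Hypotheses (a0 : forall x, 0 <= a x) (b0 : forall x, 0 <= b x).
Hypothesis mA : measurable A.

(** For v < u the difference u^2 - v^2 is at most 2 u (u - v), which Young's
    inequality with weight l splits. *)
Lemma sqr_le_min_sqr (u v l : R) : 0 <= u -> 0 <= v -> 0 < l ->
  u ^+ 2 <= Num.min u v ^+ 2 + (l^-1 * u ^+ 2 + l * (u - v) ^+ 2).
Proof.
move=> u0 v0 l0; have l'0 : 0 < l^-1 by rewrite invr_gt0.
case: (leP u v) => [uv|vu].
  by rewrite lerDl addr_ge0// mulr_ge0 ?sqr_ge0// ltW.
have h : 0 <= l^-1 * (u - l * (u - v)) ^+ 2.
  by rewrite mulr_ge0 ?sqr_ge0// ltW.
have -> : l^-1 * u ^+ 2 + l * (u - v) ^+ 2 =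
    l^-1 * (u - l * (u - v)) ^+ 2 + 2 * u * (u - v).
  by field; rewrite gt_eqF.
have h2 : 0 <= (u - v) ^+ 2 by exact: sqr_ge0.
nra.
Qed.

Lemma mass_deficit (l : R) : 0 < l ->
  (\int[mu]_(x in A) (a x ^+ 2)%:E <=
   \int[mu]_(x in A) (Num.min (a x) (b x) ^+ 2)%:E +
   ((l^-1)%:E * \int[mu]_(x in A) (a x ^+ 2)%:E +
    l%:E * \int[mu]_(x in A) ((a x - b x) ^+ 2)%:E))%E.
Proof.
move=> l0; have l'0 : 0 < l^-1 by rewrite invr_gt0.
have ma2 : measurable_fun A (fun x => (a x ^+ 2)%:E).
  by apply/measurable_EFinP/measurable_funTS; exact: measurable_funX.
have mm2 : measurable_fun A (fun x => (Num.min (a x) (b x) ^+ 2)%:E).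
  apply/measurable_EFinP/measurable_funTS; apply: measurable_funX.
  exact: measurable_minr.
have md2 : measurable_fun A (fun x => ((a x - b x) ^+ 2)%:E).
  apply/measurable_EFinP/measurable_funTS; apply: measurable_funX.
  exact: measurable_funB.
have pa2 x : A x -> (0 <= (a x ^+ 2)%:E)%E by rewrite lee_fin sqr_ge0.
have pd2 x : A x -> (0 <= ((a x - b x) ^+ 2)%:E)%E by rewrite lee_fin sqr_ge0.
have ml1 : measurable_fun A (fun x => (l^-1)%:E * (a x ^+ 2)%:E)%E.
  exact: measurable_funeM.
have ml2 : measurable_fun A (fun x => l%:E * ((a x - b x) ^+ 2)%:E)%E.
  exact: measurable_funeM.
rewrite -!ge0_integralZl_EFin//; [|exact: ltW|exact: ltW].
rewrite -ge0_integralD//; last 2 first.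
- by move=> x Ax; rewrite mule_ge0// ?lee_fin ?sqr_ge0// ltW.
- by move=> x Ax; rewrite mule_ge0// ?lee_fin ?sqr_ge0// ltW.
rewrite -ge0_integralD//; last 3 first.
- by move=> x _; rewrite lee_fin sqr_ge0.
- move=> x Ax; rewrite adde_ge0// mule_ge0// ?lee_fin ?sqr_ge0// ltW//.
- exact: emeasurable_funD.
apply: ge0_le_integral => //.
- by apply: emeasurable_funD => //; exact: emeasurable_funD.
- by move=> x _; rewrite -!EFinM -!EFinD lee_fin sqr_le_min_sqr.
Qed.

End mass_deficit.

Section partial_coupling.
Context (R : realType) (X : ptopologicalType) (d : X -> X -> \bar R).
Hypothesis d_ge0 : forall x y, (0 <= d x y)%E.
Variables mu1 mu2 : {finite_measure set (borel X) -> \bar R}.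
Local Notation C := (cone R X).
Local Notation CC := (borel (C * C)%type).
Variables (alpha : {finite_measure set CC -> \bar R}) (l S : R).
Hypothesis l0 : 0 < l.
Hypothesis plan : hk_plan mu1 mu2 alpha.
Hypothesis cost :
  ((l ^+ 2)%:E * \int[alpha]_z (cone_dist2 (scale_dist l d) z.1 z.2)%:E <=
   S%:E)%E.

Let P : set CC := @positive_radii R X.
Let w (z : CC) : R := Num.min (cone_r z.1) (cone_r z.2) ^+ 2.

Let w_ge0 z : 0 <= w z. Proof. exact: sqr_ge0. Qed.

Let mw (D : set CC) : measurable_fun D (fun z => (w z)%:E).
Proof.
apply/measurable_EFinP/measurable_funTS; apply: measurable_funX.
by apply: measurable_minr; [exact: measurable_cone_r1|exact: measurable_cone_r2].
Qed.

Let w_le z : w z <= cone_r z.1 * cone_r z.2.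
Proof.
rewrite /w expr2; have r1 := cone_r_ge0 z.1; have r2 := cone_r_ge0 z.2.
by apply: ler_pM; rewrite ?le_min ?r1 ?r2// ge_min lexx ?orbT.
Qed.

Let w_out z : ~ P z -> w z = 0.
Proof.
move=> nPz; have r1 := cone_r_ge0 z.1; have r2 := cone_r_ge0 z.2.
rewrite /w; suff -> : Num.min (cone_r z.1) (cone_r z.2) = 0 by rewrite expr0n.
apply/eqP; rewrite eq_le le_min r1 r2 !andbT leNgt lt_min.
by apply/negP => /andP[? ?]; exact: nPz.
Qed.

(** The weight min(r1, r2)^2 is at most r1^2 and r2^2, which keeps both
    marginals below [mu1] and [mu2]; it is also at most r1 r2, the coefficient
    of the angular cost.  It vanishes where one of the radii does, so only pairs
    with positive radii contribute. *)
Definition partial_coupling (A : set (borel (X * X)%type)) : R :=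
  fine (\int[alpha]_(z in P `&` @base_points R X @^-1` A) (w z)%:E)%E.

Let mPA (A : set (borel (X * X)%type)) : measurable A ->
  measurable (P `&` @base_points R X @^-1` A).
Proof.
by apply: measurable_base_points; exact: measurable_positive_radii.
Qed.

Let partial_couplingE (A : set (borel (X * X)%type)) : measurable A ->
  (partial_coupling A)%:E =
  (\int[alpha]_(z in P `&` @base_points R X @^-1` A) (w z)%:E)%E.
Proof.
move=> mA; rewrite fineK// ge0_fin_numE; last first.
  by apply: integral_ge0 => z _; rewrite lee_fin.
have [_ h _ _] := plan; apply: le_lt_trans h.
rewrite integral_mkcond; apply: le_integralT => z.
  by apply: erestrict_ge0 => x _; rewrite lee_fin.
rewrite /patch; case: ifP => _; last first.
  by rewrite lee_fin addr_ge0 ?sqr_ge0.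
rewrite lee_fin (le_trans (w_le z))//.
have := sqr_ge0 (cone_r z.1 - cone_r z.2).
have := sqr_ge0 (cone_r z.1 + cone_r z.2).
nra.
Qed.

Lemma partial_coupling_ge0 A : 0 <= partial_coupling A.
Proof. by apply: fine_ge0; apply: integral_ge0 => z _; rewrite lee_fin. Qed.

Lemma partial_coupling_add A B : measurable A -> measurable B ->
  A `&` B = set0 ->
  partial_coupling (A `|` B) = partial_coupling A + partial_coupling B.
Proof.
move=> mA mB AB; apply: EFin_inj.
rewrite EFinD !partial_couplingE//; last exact: measurableU.
rewrite preimage_setU setIUr ge0_integral_setU//;
  [exact: mPA|exact: mPA|by move=> z _; rewrite lee_fin|].
rewrite disj_set2E; apply/eqP; rewrite setIACA -preimage_setI AB.
by rewrite preimage_set0 setI0.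
Qed.

Let sqr_diff_le_cost (A : set CC) (r r' : CC -> R) :
  (forall z, (r z - r' z) ^+ 2 = (cone_r z.1 - cone_r z.2) ^+ 2) ->
  (l%:E * \int[alpha]_(z in A) ((r z - r' z) ^+ 2)%:E <= (S / l)%:E)%E.
Proof.
move=> rr'; rewrite -(@lee_pmul2l _ l%:E) ?lte_fin// muleA -!EFinM.
rewrite -expr2 mulrC divfK ?gt_eqF//; apply: le_trans cost.
rewrite lee_pmul2l ?lte_fin ?exprn_gt0//.
rewrite integral_mkcond; apply: le_integralT => z.
  by apply: erestrict_ge0 => x _; rewrite lee_fin sqr_ge0.
rewrite /patch; case: ifP => _; last by rewrite lee_fin cone_dist2_ge0.
rewrite lee_fin rr' cone_dist2E lerDl.
by rewrite !mulr_ge0 ?cone_r_ge0 ?sin_half_angle_ge0.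
Qed.

(** Common to both marginals: [r] and [x] are the radius and the base point of
    one component, [r'] is the radius of the other. *)
Let marginal_bounds (r r' : CC -> R) (x : CC -> borel X)
    (mu : {finite_measure set (borel X) -> \bar R}) (A : set (borel X)) :
  measurable_fun setT r -> measurable_fun setT r' -> measurable_fun setT x ->
  (forall z, 0 <= r z) -> (forall z, 0 <= r' z) ->
  (forall z, (r z - r' z) ^+ 2 = (cone_r z.1 - cone_r z.2) ^+ 2) ->
  (forall z, Num.min (r z) (r' z) ^+ 2 = w z) ->
  (forall B, measurable B -> (\int[alpha]_(z in x @^-1` B) (r z ^+ 2)%:E)%E = mu B) ->
  measurable A ->
  ((\int[alpha]_(z in P `&` x @^-1` A) (w z)%:E <= mu A) /\
   (mu A <= \int[alpha]_(z in P `&` x @^-1` A) (w z)%:E +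
      ((fine (mu setT) + S) / l)%:E))%E.
Proof.
move=> mr mr' mx r0 r'0 rr' rw muE mA.
have mxA : measurable (x @^-1` A : set CC).
  by rewrite -[_ @^-1` _]setTI; exact: mx.
have -> : (\int[alpha]_(z in P `&` x @^-1` A) (w z)%:E =
    \int[alpha]_(z in x @^-1` A) (Num.min (r z) (r' z) ^+ 2)%:E)%E.
  rewrite integral_mkcond [RHS]integral_mkcond; apply: eq_integral => z _.
  rewrite /patch in_setI rw; case: (z \in x @^-1` A); rewrite ?andbF ?andbT//.
  case: ifPn => //; rewrite notin_setE => /w_out ->//.
split.
  rewrite -muE//; apply: ge0_le_integral => //.
  - by move=> z _; rewrite lee_fin sqr_ge0.
  - apply/measurable_EFinP/measurable_funTS; apply: measurable_funX.
    exact: measurable_minr.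
  - by apply/measurable_EFinP/measurable_funTS; exact: measurable_funX.
  - move=> z _; rewrite lee_fin lerXn2r// ?nnegrE ?le_min ?r0 ?r'0//.
    by rewrite ge_min lexx.
rewrite -{1}muE//; apply: (le_trans (mass_deficit alpha mr mr' r0 r'0 mxA l0)).
apply: leeD2l; rewrite muE// mulrDl EFinD; apply: leeD; last first.
  exact: sqr_diff_le_cost.
rewrite mulrC EFinM lee_pmul2l ?lte_fin ?invr_gt0// fineK ?fin_num_measure//.
by apply: le_measure; rewrite ?inE.
Qed.

Lemma partial_coupling_fst (A : set (borel X)) : measurable A ->
  fine (mu1 A) - (fine (mu1 setT) + S) / l <= partial_coupling (fst @^-1` A)
  <= fine (mu1 A).
Proof.
move=> mA; have [_ _ h _] := plan.
have mfA : measurable (fst @^-1` A : set (borel (X * X)%type)).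
  by rewrite -[_ @^-1` _]setTI; exact: fst_borel.
have [||||||||h1 h2] := @marginal_bounds (fun z => cone_r z.1)
  (fun z => cone_r z.2) (fun z => cone_x z.1) mu1 A _ _ _ _ _ _ _ _ mA.
- exact: measurable_cone_r1.
- exact: measurable_cone_r2.
- exact: measurable_cone_x1.
- by move=> z; exact: cone_r_ge0.
- by move=> z; exact: cone_r_ge0.
- by [].
- by [].
- by move=> B mB; rewrite -h.
have m1A : (mu1 A = (fine (mu1 A))%:E)%E by rewrite fineK// fin_num_measure.
move: h1 h2; rewrite -(partial_couplingE mfA) m1A -EFinD !lee_fin => h1 h2.
by rewrite h1 andbT lerBlDr.
Qed.

Lemma partial_coupling_snd (A : set (borel X)) : measurable A ->
  fine (mu2 A) - (fine (mu2 setT) + S) / l <= partial_coupling (snd @^-1` A)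
  <= fine (mu2 A).
Proof.
move=> mA; have [_ _ _ h] := plan.
have mfA : measurable (snd @^-1` A : set (borel (X * X)%type)).
  by rewrite -[_ @^-1` _]setTI; exact: snd_borel.
have [||||||||h1 h2] := @marginal_bounds (fun z => cone_r z.2)
  (fun z => cone_r z.1) (fun z => cone_x z.2) mu2 A _ _ _ _ _ _ _ _ mA.
- exact: measurable_cone_r2.
- exact: measurable_cone_r1.
- exact: measurable_cone_x2.
- by move=> z; exact: cone_r_ge0.
- by move=> z; exact: cone_r_ge0.
- by move=> z; rewrite -sqrrN opprB.
- by move=> z; rewrite minC.
- by move=> B mB; rewrite -h.
have m2A : (mu2 A = (fine (mu2 A))%:E)%E by rewrite fineK// fin_num_measure.
move: h1 h2; rewrite -(partial_couplingE mfA) m2A -EFinD !lee_fin => h1 h2.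
by rewrite h1 andbT lerBlDr.
Qed.

(** The sum over [k] is the integral of a step function below the truncated
    squared distance, so the cost of the plan dominates it. *)
Lemma partial_coupling_cost (N : nat) (G : nat -> set (X * X)) (e T : R) :
  (forall k, open (G k)) -> 0 < e -> 0 < T -> T <= l * pi ->
  0 < cos (T / (2 * l)) ->
  (forall p, \sum_(k < N) e * \1_(G k) p <= fine (Order.min (d p.1 p.2) T%:E) ^+ 2) ->
  cos (T / (2 * l)) ^+ 2 * e * \sum_(k < N) partial_coupling (G k) <= S.
Proof.
move=> oG e0 T0 Tl cos0 eG; set c := cos _ ^+ 2 * e.
have c0 : 0 < c by rewrite mulr_gt0// exprn_gt0.
have mG k : measurable (G k : set (borel (X * X)%type)) by exact: open_borel.
have mPG k := mPA (mG k).
rewrite -lee_fin; apply: le_trans cost.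
rewrite EFinM -sumEFin; under eq_bigr do rewrite (partial_couplingE (mG _)).
rewrite ge0_sume_distrr; last first.
  by move=> k _; apply: integral_ge0 => z _; rewrite lee_fin.
pose B k := P `&` @base_points R X @^-1` (G k).
have -> : (\sum_(k < N) c%:E * \int[alpha]_(z in B k) (w z)%:E =
    \sum_(k < N) \int[alpha]_z ((fun z => (c * w z)%:E) \_ (B k)) z)%E.
  apply: eq_bigr => k _; rewrite -ge0_integralZl_EFin//.
  - by rewrite integral_mkcond.
  - exact: mPG.
  - by move=> z _; rewrite lee_fin.
  - exact: ltW.
rewrite -ge0_integral_sum//; last 2 first.
- move=> k; apply: (measurable_restrictT (fun z => (c * w z)%:E) (mPG k)).1.
  apply/measurable_EFinP; apply: measurable_funM => //.
  by apply/measurable_EFinP; exact: mw.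
- move=> k z _; apply: erestrict_ge0 => x _.
  by rewrite lee_fin mulr_ge0// ltW.
rewrite -integralZl_pos ?exprn_gt0//; last first.
  by move=> z; rewrite lee_fin cone_dist2_ge0.
apply: le_integralT => z.
  by apply: sume_ge0 => k _; apply: erestrict_ge0 => x _; rewrite lee_fin mulr_ge0// ltW.
have [Pz|nPz] := pselect (P z); last first.
  rewrite big1; last first.
    move=> k _; rewrite /patch; case: ifPn => // _.
    by rewrite w_out// mulr0.
  by rewrite mule_ge0// lee_fin ?sqr_ge0// cone_dist2_ge0.
have -> : (\sum_(k < N) ((fun z => (c * w z)%:E) \_ (B k)) z =
    (cos (T / (2 * l)) ^+ 2 * w z *
     \sum_(k < N) e * \1_(G k) (base_points z))%:E)%E.
  rewrite mulr_sumr -sumEFin; apply: eq_bigr => k _.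
  rewrite /patch /B in_setI mem_set//= indicE.
  have -> : (z \in @base_points R X @^-1` G k) = (base_points z \in G k).
    by apply/idP/idP; rewrite !inE.
  case: ifP => _; last by rewrite !mulr0.
  by rewrite mulr1 /c; congr EFin; ring.
rewrite -EFinM lee_fin; set f := \sum_(k < N) _.
have [r1 r2] := Pz.
rewrite cone_dist2E !repr_cone_x// mulrDr.
apply: (@le_trans _ _ (w z *
    (l ^+ 2 * (4 * sin (cone_angle l (d (cone_x z.1) (cone_x z.2)) / 2) ^+ 2)))).
  rewrite (mulrC _ (w z)) -mulrA ler_wpM2l//.
  apply: le_trans (truncated_dist_le_chord T0 Tl l0 (d_ge0 _ _)).
  by rewrite mulrC ler_wpM2r ?sqr_ge0//; exact: eG.
apply: (@le_trans _ _ (cone_r z.1 * cone_r z.2 *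
    (l ^+ 2 * (4 * sin (cone_angle l (d (cone_x z.1) (cone_x z.2)) / 2) ^+ 2)))).
  apply: ler_wpM2r => //.
  by rewrite mulr_ge0 ?sqr_ge0// pmulr_rge0// sqr_ge0.
rewrite mulrCA lerDr mulr_ge0 ?sqr_ge0//.
Qed.

End partial_coupling.

(** * The compactness step *)

Section staircase.
Context (R : realType).
Implicit Types (f e : R) (N : nat).

(** A step function of [f] with steps of height [e].  When [f] is lower
    semicontinuous each summand is a multiple of the indicator of an open
    set. *)
Definition staircase f e N : R := \sum_(k < N) e * (k.+1%:R * e < f)%R%:R.

Lemma staircase_le f e N : 0 <= f -> 0 < e -> staircase f e N <= f.
Proof.
move=> f0 e0.
suff /andP[] : (staircase f e N <= f) && (staircase f e N <= N%:R * e) by [].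
elim: N => [|N /andP[h1 h2]].
  by rewrite /staircase big_ord0 f0 mul0r lexx.
rewrite /staircase big_ord_recr/= -/(staircase f e N).
have -> : N.+1%:R * e = N%:R * e + e by rewrite -natr1 mulrDl mul1r.
case: ltP => h; rewrite ?mulr1 ?mulr0 ?addr0; last first.
  by rewrite h1/= (le_trans h2)// lerDl ltW.
by rewrite lerD// andbT (le_trans _ (ltW h))// lerD.
Qed.

Lemma staircase_ge f e N : 0 < e -> f <= N.+1%:R * e ->
  f <= staircase f e N + e.
Proof.
move=> e0 fN.
suff : Num.min f (N.+1%:R * e) <= staircase f e N + e by rewrite min_l.
elim: N {fN} => [|N]; first by rewrite /staircase big_ord0 mul1r add0r ge_min lexx orbT.
rewrite [X in _ -> _ <= X + _]/staircase big_ord_recr/= -/(staircase f e N).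
case: (ltP (N.+1%:R * e) f) => h; rewrite ?mulr1 ?mulr0 ?addr0; last first.
  by move=> ?; rewrite ge_min; apply/orP; left.
move=> ih; rewrite ge_min; apply/orP; right.
by rewrite -[N.+2%:R]natr1 mulrDl mul1r lerD2r.
Qed.

End staircase.

Section truncated_distance.
Context (R : realType).
Implicit Types (D : \bar R) (T a : R).

Lemma truncated_bounds D T : (0 <= D)%E -> 0 <= T ->
  0 <= fine (Order.min D T%:E) <= T.
Proof.
move=> D0 T0; case: D D0 => [r|_|] //; [rewrite lee_fin => r0|].
  by rewrite -EFin_min/= le_min r0 T0/= ge_min lexx orbT.
by rewrite minye /= lexx T0.
Qed.

Lemma lt_truncated_sqr D T a : (0 <= D)%E -> 0 <= T -> 0 <= a ->
  (a < fine (Order.min D T%:E) ^+ 2) =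
  (Num.sqrt a < T) && ((Num.sqrt a)%:E < D)%E.
Proof.
move=> D0 T0 a0; have /andP[t0 _] := truncated_bounds D0 T0.
rewrite -{1}(sqr_sqrtr a0) ltr_pXn2r// ?nnegrE ?sqrtr_ge0//.
case: D D0 {t0} => [r|_|] //; [rewrite lee_fin => r0|].
  by rewrite -EFin_min/= lt_min lte_fin andbC.
by rewrite minye/= ltry andbT.
Qed.

End truncated_distance.

Section coupling_of_plans.
Context (R : realType) (X : ptopologicalType) (d : X -> X -> \bar R).
Hypothesis hd : extended_metric_topological d.
Variables mu1 mu2 : {finite_measure set (borel X) -> \bar R}.
Hypotheses (rmu1 : radon mu1) (rmu2 : radon mu2).
Variable S : R.
Hypothesis plans : forall l : R, 0 < l ->
  exists2 alpha, hk_plan mu1 mu2 alpha &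
    ((l ^+ 2)%:E * \int[alpha]_z (cone_dist2 (scale_dist l d) z.1 z.2)%:E <=
     S%:E)%E.

Let d_ge0 : forall x y, (0 <= d x y)%E := emt_ge0 hd.

Let f (T : R) (p : X * X) : R := fine (Order.min (d p.1 p.2) T%:E) ^+ 2.

Let f_ge0 T p : 0 <= f T p. Proof. exact: sqr_ge0. Qed.

Let f_le T p : 0 <= T -> f T p <= T ^+ 2.
Proof.
move=> T0; have /andP[t0 tT] := truncated_bounds (d_ge0 p.1 p.2) T0.
by rewrite lerXn2r// nnegrE.
Qed.

Let open_f (T a : R) : 0 <= T -> 0 <= a -> open [set p | a < f T p].
Proof.
move=> T0 a0.
have -> : [set p | a < f T p] = [set p | Num.sqrt a < T /\
    ((Num.sqrt a)%:E < d p.1 p.2)%E].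
  by apply/seteqP; split=> p /=; rewrite /f lt_truncated_sqr// => /andP.
have [aT|aT] := ltP (Num.sqrt a) T; last first.
  by rewrite (_ : [set _ | _] = set0); [exact: open0|apply/seteqP; split=> p []].
rewrite (_ : [set _ | _] = [set p | ((Num.sqrt a)%:E < d p.1 p.2)%E]).
  by have /lower_semicontinuousP := emt_lsc hd; exact.
by apply/seteqP; split=> p // [].
Qed.

Let layer_set T e k := [set p | k.+1%:R * e < f T p].

Let sum_layer T e N p :
  \sum_(k < N) e * \1_(layer_set T e k) p = staircase (f T p) e N.
Proof.
apply: eq_bigr => k _; rewrite indicE /layer_set.
by congr (_ * _%:R); congr nat_of_bool; apply/idP/idP; rewrite inE.
Qed.

Let S_ge0 : 0 <= S.
Proof.
have [alpha _ h] := plans ltr01; rewrite -lee_fin; apply: le_trans h.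
rewrite mule_ge0// ?lee_fin ?sqr_ge0//.
by apply: integral_ge0 => z _; rewrite lee_fin cone_dist2_ge0.
Qed.

Import HBNNSimple.

(** A simple function is bounded, so it lies below the squared distance exactly
    when it lies below some truncation of it; this replaces monotone
    convergence in [T]. *)
Let truncated_cost (gamma : {finite_measure set (borel (X * X)%type) -> \bar R}) :
  (forall T, 0 < T -> (\int[gamma]_p (f T p)%:E <= S%:E)%E) ->
  (\int[gamma]_p (d p.1 p.2 ^+ 2) <= S%:E)%E.
Proof.
move=> h; apply: ge0_integral_le => [p|u ud]; first exact: expe_ge0.
have [M [_ uM]] := simple_bounded u.
(* T >= 1 gives M <= T <= T ^+ 2. *)
pose T := Num.max 1 (M + 1).
have T1 : 1 <= T by rewrite le_max lexx.
have T0 : 0 < T by rewrite (lt_le_trans ltr01).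
have uT (p : borel (X * X)%type) : u p <= T ^+ 2.
  apply: (@le_trans _ _ T); last by rewrite expr2 ler_peMl// ltW.
  rewrite (le_trans (ler_norm _))//; apply: uM => //.
  by rewrite lt_max ltrDl ltr01 orbT.
apply: le_trans (h T T0); apply: le_integralT => p; first by rewrite lee_fin.
have := ud p; rewrite /f.
have [dT|Td] := leP (d p.1 p.2) T%:E; last by rewrite /= lee_fin.
have dfin : d p.1 p.2 \is a fin_num.
  by rewrite ge0_fin_numE// (le_lt_trans dT)// ltry.
by rewrite -{1}(fineK dfin) -EFin_expe.
Qed.

Lemma coupling_of_plans : exists2 gamma, coupling mu1 mu2 gamma &
  (\int[gamma]_p (d p.1 p.2 ^+ 2) <= S%:E)%E.
Proof.
pose l n : R := n.+1%:R.
have l0 n : 0 < l n by rewrite ltr0n.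
have /choice[alpha alphaP] n : exists alpha, hk_plan mu1 mu2 alpha /\
    (((l n) ^+ 2)%:E *
     \int[alpha]_z (cone_dist2 (scale_dist (l n) d) z.1 z.2)%:E <= S%:E)%E.
  by have [alpha ? ?] := plans (l0 n); exists alpha.
pose g n := partial_coupling (alpha n).
have cvg_div (K : R) : K / l n @[n --> \oo] --> 0.
  have -> : 0 = K * 0 :> R by rewrite mulr0.
  by apply: cvgM; [exact: cvg_cst|exact: cvg_harmonic].
have cvg_low (a K : R) : a - K / l n @[n --> \oo] --> a.
  rewrite -{2}[a]subr0; apply: cvgB; [exact: cvg_cst|exact: cvg_div].
have [A mA|A mA|gamma cg gG] := @exists_asymptotic_coupling R X mu1 mu2 g
  (emt_hausdorff hd) rmu1 rmu2
  (fun n A _ => @partial_coupling_ge0 R X (alpha n) A)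
  (fun n => partial_coupling_add (alphaP n).1).
- apply: squeeze_cvgr (cvg_low (fine (mu1 A)) (fine (mu1 setT) + S)) (cvg_cst _).
  apply: nearW => n; have [aP ac] := alphaP n.
  exact: (partial_coupling_fst d_ge0 (l0 n) aP ac).
- apply: squeeze_cvgr (cvg_low (fine (mu2 A)) (fine (mu2 setT) + S)) (cvg_cst _).
  apply: nearW => n; have [aP ac] := alphaP n.
  exact: (partial_coupling_snd d_ge0 (l0 n) aP ac).
exists gamma => //; apply: truncated_cost => // T T0.
apply/lee_addgt0Pr => eta eta0.
pose M := fine (gamma setT).
have M0 : 0 <= M by exact: fine_ge0.
have MS0 : 0 < M + S + 1 by rewrite ltr_wpDl// addr_ge0.
(* Steps of height e cost e M, and the cosine factor, which tends to 1, is
   eventually at least (1 + e)^-1 and costs e S. *)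
pose e := eta / (M + S + 1).
have e0 : 0 < e by rewrite divr_gt0.
pose N := Num.truncn (T ^+ 2 / e).
have fN p : f T p <= N.+1%:R * e.
  apply: (le_trans (f_le _ (ltW T0))).
  by rewrite -ler_pdivrMr// ltW// truncnS_gt.
have oG k : open (layer_set T e k).
  by apply: open_f; [exact: ltW|rewrite mulr_ge0// ltW].
have mG k : measurable (layer_set T e k : set (borel (X * X)%type)).
  exact: open_borel.
have e1 : 0 < 1 + e by rewrite ltr_wpDr// ltW.
have cvg_cos : cos (T / (2 * l n)) @[n --> \oo] --> (1 : R).
  have xc : T / (2 * l n) @[n --> \oo] --> (0 : R).
    have -> : (fun n => T / (2 * l n)) = (fun n => (T / 2) / l n).
      by apply/funext => n; rewrite invfM mulrA.
    exact: cvg_div.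
  have := cvg_comp _ _ xc (@continuous_cos R 0).
  by rewrite cos0.
have cvg_cos2 : cos (T / (2 * l n)) ^+ 2 @[n --> \oo] --> (1 : R).
  rewrite -[X in _ --> X](mulr1 (1 : R)); under eq_fun do rewrite expr2.
  exact: cvgM.
have /(_ N (layer_set T e) (S * (1 + e) / e) oG) gN := gG.
have {}gN : (\sum_(k < N) gamma (layer_set T e k) <= (S * (1 + e) / e)%:E)%E.
  apply: gN; near=> n.
  have [aP ac] := alphaP n.
  have Tl : T <= l n * pi.
    apply: (@le_trans _ _ (l n)); last first.
      by apply: ler_peMr; [exact: ltW|rewrite (le_trans _ (pi_ge2 R))// ler1n].
    apply: (@le_trans _ _ n%:R); last by rewrite ler_nat.
    by near: n; exact: nbhs_infty_ger.
  have cos0 : 0 < cos (T / (2 * l n)).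
    by near: n; apply: (cvgr_gt _ cvg_cos); exact: ltr01.
  have cos1 : (1 + e)^-1 < cos (T / (2 * l n)) ^+ 2.
    near: n; apply: (cvgr_gt _ cvg_cos2).
    by rewrite invf_lt1// ltrDl.
  have := partial_coupling_cost d_ge0 (l0 n) aP ac oG e0 T0 Tl cos0 _.
  move=> /(_ N); set s := \sum_(k < N) _ => h.
  have {}h : cos (T / (2 * l n)) ^+ 2 * e * s <= S.
    by apply: h => p; rewrite sum_layer staircase_le.
  have s0 : 0 <= s by apply: sumr_ge0 => k _; exact: partial_coupling_ge0.
  rewrite ler_pdivlMr// -ler_pdivrMr//; apply: le_trans h.
  have -> : s * e / (1 + e) = (1 + e)^-1 * (e * s) by ring.
  rewrite -[leRHS]mulrA.
  by apply: ler_wpM2r; [rewrite mulr_ge0// ltW|exact: ltW].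
have mind k : measurable_fun setT
    (fun p : borel (X * X)%type => (\1_(layer_set T e k) p)%:E : \bar R).
  by apply/measurable_EFinP; exact: measurable_indic.
apply: (@le_trans _ _ (\int[gamma]_p
    (e%:E + \sum_(k < N) e%:E * (\1_(layer_set T e k) p)%:E))%E).
  apply: le_integralT => p; first by rewrite lee_fin.
  under eq_bigr do rewrite -EFinM.
  by rewrite sumEFin sum_layer -EFinD lee_fin addrC staircase_ge.
have pos (k : nat) p : (0 <= e%:E * (\1_(layer_set T e k) p)%:E)%E.
  by rewrite mule_ge0// lee_fin// ltW.
rewrite ge0_integralD//; last 3 first.
- by move=> p _; rewrite lee_fin ltW.
- by move=> p _; apply: sume_ge0 => k _.
- by apply: emeasurable_sum => k; exact: measurable_funeM.
rewrite integral_cst// ge0_integral_sum//; last 1 first.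
- by move=> k; exact: measurable_funeM.
have -> : (\sum_(k < N) \int[gamma]_p (e%:E * (\1_(layer_set T e k) p)%:E) =
    e%:E * \sum_(k < N) gamma (layer_set T e k))%E.
  rewrite ge0_sume_distrr//; apply: eq_bigr => k _.
  rewrite ge0_integralZl_EFin//; last exact: ltW.
  by rewrite integral_indic// setIT.
apply: (@le_trans _ _ (e%:E * M%:E + e%:E * (S * (1 + e) / e)%:E)%E).
  apply: leeD; first by rewrite /M fineK// fin_num_measure.
  by rewrite lee_pmul2l// lte_fin.
rewrite -!EFinM -EFinD lee_fin mulrCA divff ?gt_eqF// mulr1.
have -> : eta = e * (M + S + 1) by rewrite /e divfK// gt_eqF.
have := mulr_ge0 (ltW e0) S_ge0; nra.
Unshelve. all: by end_near. Qed.

End coupling_of_plans.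

(** * Monotonicity and convergence *)

(** Monotonicity is only assumed on the positive half-line, so the function is
    frozen below 1, which does not change it near infinity. *)
Lemma monotone_cvg_sup (R : realType) (F : R -> \bar R) (L : \bar R) :
  (forall l, 0 < l -> (0 <= F l)%E) ->
  (forall l1 l2, 0 < l1 -> l1 <= l2 -> (F l1 <= F l2)%E) ->
  (forall l, 0 < l -> (F l <= L)%E) ->
  (forall S : R, (forall l, 0 < l -> (F l <= S%:E)%E) -> (L <= S%:E)%E) ->
  F @ +oo --> L.
Proof.
move=> F0 Fmono FL Lsup.
pose F' l := F (Num.max l 1).
have max_gt0 (l : R) : 0 < Num.max l 1 by rewrite lt_max ltr01 orbT.
have F'mono : {homo F' : x y / x <= y >-> (x <= y)%E}.
  move=> x y xy; apply: Fmono => //.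
  by rewrite ge_max !le_max xy lexx orbT.
have F'F : \forall l \near +oo, F' l = F l.
  near=> l; rewrite /F' max_l//; near: l; exact: nbhs_pinfty_ge.
have -> : L = ereal_sup (range F').
  apply/eqP; rewrite eq_le; apply/andP; split; last first.
    by apply: ge_ereal_sup => _ [l _ <-]; exact: FL.
  have F'_sup l : (F' l <= ereal_sup (range F'))%E.
    by apply: ereal_sup_ubound; exists l.
  have sup0 := le_trans (F0 _ (max_gt0 1)) (F'_sup 1).
  case: (ereal_sup _) sup0 F'_sup => [S|_ _|] //; last exact: leey.
  move=> _ F'_sup.
  apply: Lsup => l l0; apply: le_trans (F'_sup l).
  by apply: Fmono => //; rewrite le_max lexx.
apply: cvg_trans (nondecreasing_cvge F'mono).
exact: near_eq_cvg.
Unshelve. all: by end_near. Qed.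

Section scaled_cost.
Context (R : realType) (X : ptopologicalType) (d : X -> X -> \bar R).
Hypothesis hd : extended_metric_topological d.
Variables mu1 mu2 : {finite_measure set (borel X) -> \bar R}.
Local Open Scope ereal_scope.

Let d_ge0 : forall x y, 0 <= d x y := emt_ge0 hd.

Let hk_costs (l : R) : set (\bar R) :=
  [set \int[alpha]_z ((cone_dist2 (scale_dist l d) z.1 z.2)%:E)
     | alpha in hk_plan mu1 mu2].

Let wass_costs : set (\bar R) :=
  [set \int[gamma]_p (d p.1 p.2 ^+ 2) | gamma in coupling mu1 mu2].

Definition scaled_cost (l : R) : \bar R :=
  (l ^+ 2)%:E * ereal_inf (hk_costs l).

Let hk_inf_ge0 l : 0 <= ereal_inf (hk_costs l).
Proof.
apply: le_ereal_inf_tmp => _ [alpha _ <-]; apply: integral_ge0 => z _.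
by rewrite lee_fin cone_dist2_ge0.
Qed.

Lemma scaled_cost_ge0 l : 0 <= scaled_cost l.
Proof. by rewrite mule_ge0// lee_fin sqr_ge0. Qed.

Lemma scaled_HK l : (0 < l)%R ->
  l%:E * HK (scale_dist l d) mu1 mu2 = sqrte (scaled_cost l).
Proof.
move=> l0; rewrite /scaled_cost sqrteM ?lee_fin ?sqr_ge0//.
by congr (_ * _); rewrite /= sqrtr_sqr ger0_norm// ltW.
Qed.

Lemma scaled_cost_monotone l1 l2 : (0 < l1)%R -> (l1 <= l2)%R ->
  scaled_cost l1 <= scaled_cost l2.
Proof.
move=> l10 l12; have l20 := lt_le_trans l10 l12.
rewrite -lee_pdivrMl ?exprn_gt0//.
apply: le_ereal_inf_tmp => _ [alpha ap <-].
rewrite lee_pdivrMl ?exprn_gt0//.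
apply: (@le_trans _ _ ((l1 ^+ 2)%:E *
    \int[alpha]_z (cone_dist2 (scale_dist l1 d) z.1 z.2)%:E)).
  rewrite lee_pmul2l ?lte_fin ?exprn_gt0//.
  by apply: ereal_inf_lbound; exists alpha.
rewrite -!integralZl_pos ?exprn_gt0//.
- apply: le_integralT => z.
    by rewrite -EFinM lee_fin mulr_ge0 ?sqr_ge0// cone_dist2_ge0.
  by rewrite -!EFinM lee_fin cone_dist2_monotone.
- by move=> z; rewrite lee_fin cone_dist2_ge0.
- by move=> z; rewrite lee_fin cone_dist2_ge0.
Qed.

Lemma scaled_cost_le_wass l : (0 < l)%R ->
  scaled_cost l <= ereal_inf wass_costs.
Proof.
move=> l0; apply: le_ereal_inf_tmp => _ [gamma cg <-].
have [alpha ap /(_ _ l0)] := plan_of_coupling d_ge0 cg.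
apply: le_trans; rewrite lee_pmul2l ?lte_fin ?exprn_gt0//.
by apply: ereal_inf_lbound; exists alpha.
Qed.

(** An infimum at most [S] yields plans of cost at most [S + e], which
    [coupling_of_plans] turns into one coupling with the same bound. *)
Lemma wass_le_of_scaled_cost (S : R) : radon mu1 -> radon mu2 ->
  (forall l, (0 < l)%R -> scaled_cost l <= S%:E) ->
  ereal_inf wass_costs <= S%:E.
Proof.
move=> rmu1 rmu2 h; apply/lee_addgt0Pr => e e0.
have [l l0|gamma cg] := @coupling_of_plans R X d hd mu1 mu2 rmu1 rmu2 (S + e).
  have [_ [alpha ap <-] /ltW ac] : exists2 x, hk_costs l x &
      x < ((l ^+ 2)^-1 * (S + e))%:E.
    apply: ereal_inf_lt; rewrite EFinM.
    rewrite lte_pdivlMl ?exprn_gt0//; apply: (le_lt_trans (h _ l0)).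
    by rewrite lte_fin ltrDl.
  by exists alpha => //; rewrite -lee_pdivlMl ?exprn_gt0// -EFinM.
rewrite -EFinD; apply: le_trans.
by apply: ereal_inf_lbound; exists gamma.
Qed.

End scaled_cost.

Unset Implicit Arguments.

Theorem theorem7p24 (R : realType) (X : ptopologicalType)
    (d : X -> X -> \bar R)
    (hd : extended_metric_topological d)
    (mu1 mu2 : {finite_measure set (borel X) -> \bar R})
    (hmu1 : radon mu1) (hmu2 : radon mu2) :
  (forall l1 l2 : R, 0 < l1 -> l1 <= l2 ->
    (l1%:E * HK (scale_dist l1 d) mu1 mu2 <=
     l2%:E * HK (scale_dist l2 d) mu1 mu2)%E) /\
  ((fun l : R => l%:E * HK (scale_dist l d) mu1 mu2)%E @ +oo%R
     --> Wass d mu1 mu2).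
Proof.
have V0 : (0 <= ereal_inf [set \int[gamma]_p (d p.1 p.2 ^+ 2)
    | gamma in coupling mu1 mu2])%E.
  apply: le_ereal_inf_tmp => _ [gamma _ <-]; apply: integral_ge0 => p _.
  by rewrite expe_ge0// (emt_ge0 hd).
have mono (l1 l2 : R) : 0 < l1 -> l1 <= l2 ->
    (l1%:E * HK (scale_dist l1 d) mu1 mu2 <=
     l2%:E * HK (scale_dist l2 d) mu1 mu2)%E.
  move=> l10 l12; have l20 := lt_le_trans l10 l12.
  by rewrite !scaled_HK// lee_sqrt ?scaled_cost_ge0// scaled_cost_monotone.
split => //; apply: monotone_cvg_sup => //.
- by move=> l l0; rewrite scaled_HK// sqrte_ge0.
- by move=> l l0; rewrite scaled_HK// lee_sqrt// scaled_cost_le_wass.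
move=> S h.
have S0 : 0 <= S.
  by rewrite -lee_fin; apply: le_trans (h _ ltr01); rewrite scaled_HK// sqrte_ge0.
have -> : S%:E = sqrte (S ^+ 2)%:E by rewrite /= sqrtr_sqr ger0_norm.
rewrite lee_sqrt ?lee_fin ?sqr_ge0//; apply: wass_le_of_scaled_cost => // l l0.
rewrite -(lee_sqrt _) ?lee_fin ?sqr_ge0// -scaled_HK//.
by apply: (le_trans (h _ l0)); rewrite /= sqrtr_sqr ger0_norm.
Qed.
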